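(* Let $\vartheta$ be a primitive, compatible and recognisable set-valued substitution on a finite alphabet $\mathcal{A}$, with Perron--Frobenius eigenvalue $\lambda$ and normalised right Perron--Frobenius eigenvector $(R_a)_{a\in\mathcal{A}}$. Let $\boldsymbol{P}$ and $\boldsymbol{Q}$ be permissible probabilities for $\vartheta$, and let $\mu_{\boldsymbol{P}}$ and $\mu_{\boldsymbol{Q}}$ denote the respective frequency measures. Then, for $\mu_{\boldsymbol{Q}}$-almost all $x\in X_\vartheta$, the local dimension of $\mu_{\boldsymbol{P}}$ at $x$ exists and $$\dim_{\mathrm{loc}}(\mu_{\boldsymbol{P}},x)=\frac{1}{\lambda-1}\sum_{a\in\mathcal{A}}R_a\sum_{v\in\vartheta(a)}-\mathbb{P}[\vartheta_{\boldsymbol{Q}}(a)=v]\log\mathbb{P}[\vartheta_{\boldsymbol{P}}(a)=v].$$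
   Context: Let $\mathcal{A}$ be a finite alphabet and $\mathcal{A}^+$ the set of non-empty finite words over $\mathcal{A}$; $|v|$ is the length of $v$ and $|v|_u$ the number of (possibly overlapping) occurrences of $u$ as a subword of $v$. A set-valued substitution $\vartheta$ assigns to each letter $a$ a non-empty finite set $\vartheta(a)\subset\mathcal{A}^+$. Permissible probabilities $\boldsymbol{P}$ for $\vartheta$ are a choice, for each letter $a$, of a probability vector on $\vartheta(a)$ with all entries strictly positive; $\mathbb{P}[\vartheta_{\boldsymbol{P}}(a)=s]$ denotes the probability of $s\in\vartheta(a)$. The random substitution $\vartheta_{\boldsymbol{P}}=(\vartheta,\boldsymbol{P})$ acts on words by replacing each letter independently and concatenating; $\vartheta_{\boldsymbol{P}}^k(u)$ is the $k$-th step of the Markov chain on $\mathcal{A}^+$ started at $u$ (fresh independent choices at each step), and $\vartheta^k(u)$ is the set of words $v$ with $\mathbb{P}[\vartheta_{\boldsymbol{P}}^k(u)=v]>0$ (independent of $\boldsymbol{P}$). $\vartheta$ is compatible if for all $a,b\in\mathcal{A}$ and $u,v\in\vartheta(a)$, $|u|_b=|v|_b$; this common value is denoted $|\vartheta(a)|_b$, and $|\vartheta(a)|$ is the common length. The substitution matrix is then $M_{b,a}=|\vartheta(a)|_b$, and $\vartheta$ is primitive if some power of $M$ has all entries positive and its Perron--Frobenius eigenvalue $\lambda$ satisfies $\lambda>1$. $\boldsymbol{R}=(R_a)_{a\in\mathcal{A}}$ is the positive right eigenvector, $M\boldsymbol{R}=\lambda\boldsymbol{R}$, with $\sum_aR_a=1$.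 A word is legal if it is a subword of some element of $\vartheta^k(a)$ for some $k\in\mathbb{N}$, $a\in\mathcal{A}$. The subshift $X_\vartheta\subset\mathcal{A}^{\mathbb{Z}}$ is the set of bi-infinite sequences all of whose finite subwords are legal, and $S$ is the left shift, $S(x)_i=x_{i+1}$. For $y\in X_\vartheta$, $\vartheta(y)$ is the set of bi-infinite concatenations $\cdots v_{-2}v_{-1}.v_0v_1\cdots$ with $v_j\in\vartheta(y_j)$ for all $j$, where $v_0$ starts at position $0$. $\vartheta$ (primitive, compatible) is recognisable if for every $x\in X_\vartheta$ there is a unique $y\in X_\vartheta$ and a unique integer $k\in\{0,\dots,|\vartheta(y_0)|-1\}$ with $S^{-k}(x)\in\vartheta(y)$. For legal $v$, $[v]=\{x\in X_\vartheta:x_i=v_i,\ 1\le i\le|v|\}$. The frequency measure $\mu_{\boldsymbol{P}}$ is the unique shift-invariant Borel probability measure on $X_\vartheta$ with $\mu_{\boldsymbol{P}}([v])=\lim_{k\to\infty}\mathbb{E}[|\vartheta_{\boldsymbol{P}}^k(a)|_v]/\mathbb{E}[|\vartheta_{\boldsymbol{P}}^k(a)|]$ for every legal $v$ (the limit exists and does not depend on $a\in\mathcal{A}$, by primitivity). The local dimension is $\dim_{\mathrm{loc}}(\mu,x)=\lim_{n\to\infty}-\frac{1}{2n+1}\log\mu(\{y\in X_\vartheta:y_j=x_j\text{ for }|j|\le n\})$ when the limit exists. *)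

(* Defs.v *)
From HB Require Import structures.
From mathcomp Require Import all_boot all_order all_algebra.
From mathcomp Require Import finmap complex.
From mathcomp Require Import all_classical all_reals all_analysis.

Set Implicit Arguments.
Unset Strict Implicit.
Unset Printing Implicit Defensive.

Import Order.TTheory GRing.Theory Num.Theory.
Import numFieldNormedType.Exports.

Local Open Scope classical_set_scope.
Local Open Scope ring_scope.

Record substitution (A : finType) := Substitution {
  subst_fun :> A -> {fset seq A};
  subst_neq0 : forall a, subst_fun a != fset0;
  subst_nonempty : forall a, [::] \notin subst_fun a
}.

Section Words.
Variables (A : finType) (theta : substitution A).

Fixpoint word_image (u : seq A) : {fset seq A} :=
  if u is a :: u' then [fset s ++ w | s in theta a, w in word_image u']%fset
  else [fset [::]]%fset.

Fixpoint iter_image (k : nat) (u : seq A) : {fset seq A} :=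
  if k is k'.+1 then [fset v | w in iter_image k' u, v in word_image w]%fset
  else [fset u]%fset.

(* |v|_u, overlapping occurrences; meaningful for non-empty u. *)
Definition occ (u v : seq A) : nat :=
  count (fun i => prefix u (drop i v)) (iota 0 (size v)).

Definition legal (v : seq A) : Prop :=
  exists (k : nat) (a : A), exists2 w, w \in iter_image k [:: a] & infix v w.

Definition compatible : Prop :=
  forall (a b : A) (u v : seq A), u \in theta a -> v \in theta a ->
    count_mem b u = count_mem b v.

(* An element of theta a. For compatible theta, the letter counts and the
   length below do not depend on which one is taken. *)
Definition image_rep (a : A) : seq A := head [::] (theta a).

Definition image_count (a b : A) : nat := count_mem b (image_rep a).

Definition image_size (a : A) : nat := size (image_rep a).

(* Entry (b, a) is |theta(a)|_b; letters are indexed through enum_val. *)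
Definition subst_matrix (K : pzSemiRingType) : 'M[K]_#|A| :=
  \matrix_(i, j) (image_count (enum_val j) (enum_val i))%:R.

End Words.

Section PerronFrobenius.
Variables (R : realType) (A : finType) (theta : substitution A).

Definition PF_eigenvalue (lam : R) : Prop :=
  eigenvalue (subst_matrix theta R) lam /\
  forall z : R[i], eigenvalue (subst_matrix theta R[i]) z ->
    `|z| <= (lam%:C)%C.

Definition subst_primitive : Prop :=
  (exists2 k : nat, (0 < k)%N &
     forall i j, 0 < (subst_matrix theta R ^+ k) i j) /\
  (exists2 lam : R, PF_eigenvalue lam & 1 < lam).

Definition PF_right_eigenvector (lam : R) (r : A -> R) : Prop :=
  let rv := \col_i r (enum_val i) in
  [/\ subst_matrix theta R *m rv = lam *: rv,
      forall a, 0 < r a & \sum_a r a = 1].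

End PerronFrobenius.

Section RandomSubstitution.
Variables (R : realType) (A : finType) (theta : substitution A).

(* P a s is the probability that the letter a is replaced by s. *)
Definition permissible (P : A -> seq A -> R) : Prop :=
  forall a, [/\ forall s, s \in theta a -> 0 < P a s,
                forall s, s \notin theta a -> P a s = 0
              & \sum_(s <- theta a) P a s = 1].

Variable P : A -> seq A -> R.

(* Probability that independent replacements of the letters of u concatenate
   to v, by conditioning on the replacement of the first letter. *)
Fixpoint word_prob (u v : seq A) : R :=
  if u is a :: u' then
    \sum_(s <- theta a | prefix s v) P a s * word_prob u' (drop (size s) v)
  else (v == [::])%:R.

(* k-step transition probabilities of the Markov chain with kernel word_prob;
   iter_image k u is the support of the k-th step (iter_imageP below). *)
Fixpoint iter_prob (k : nat) (u v : seq A) : R :=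
  if k is k'.+1 then
    \sum_(w <- iter_image theta k' u) iter_prob k' u w * word_prob w v
  else (v == u)%:R.

Definition iter_mean (k : nat) (u : seq A) (f : seq A -> R) : R :=
  \sum_(w <- iter_image theta k u) iter_prob k u w * f w.

Hypothesis hP : permissible P.

Lemma word_prob_ge0 u v : 0 <= word_prob u v.
Proof.
elim: u v => [|a u IH] v /=; first by rewrite ler0n.
rewrite big_seq_cond sumr_ge0 // => s /andP[sa _].
by rewrite mulr_ge0 ?IH // ltW //; case: (hP a) => + _ _; exact.
Qed.

Lemma word_imageP u v : (v \in word_image theta u) = (0 < word_prob u v).
Proof.
elim: u v => [|a u IH] v /=.
  by rewrite in_fset1; case: eqP; rewrite ?ltr01 ?ltxx.
have [hpos _ _] := hP a.
have ge0 s : (s \in theta a) && prefix s v ->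
    0 <= P a s * word_prob u (drop (size s) v).
  by move=> /andP[sa _]; rewrite mulr_ge0 ?word_prob_ge0 // ltW // hpos.
rewrite big_seq_cond lt_def sumr_ge0 // andbT.
rewrite psumr_neq0 //.
apply/imfset2P/hasP => [[s sa [w wu ->]]|[s _ /andP[/andP[sa]]]].
  exists s; first exact: sa.
  rewrite prefix_prefix andbT; have {}sa : s \in theta a := sa; rewrite sa /=.
  by rewrite drop_size_cat // mulr_gt0 ?hpos // -IH.
move=> /prefixP[w ->]; rewrite drop_size_cat // pmulr_rgt0 ?hpos // -IH => wu.
by exists s => //; exists w.
Qed.

Lemma iter_prob_ge0 k u v : 0 <= iter_prob k u v.
Proof.
elim: k v => [|k IH] v /=; first by rewrite ler0n.
by rewrite sumr_ge0 // => w _; rewrite mulr_ge0 ?IH ?word_prob_ge0.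
Qed.

Lemma iter_imageP k u v : (v \in iter_image theta k u) = (0 < iter_prob k u v).
Proof.
elim: k v => [|k IH] v /=.
  by rewrite in_fset1; case: eqP; rewrite ?ltr01 ?ltxx.
have ge0 w : 0 <= iter_prob k u w * word_prob w v.
  by rewrite mulr_ge0 ?iter_prob_ge0 ?word_prob_ge0.
rewrite lt_def sumr_ge0 // andbT psumr_neq0 //.
apply/imfset2P/hasP => [[w wk [v' vw ->]]|[w wk /= gt0]].
  by exists w; [exact: wk | rewrite /= mulr_gt0 // -?IH // -word_imageP].
exists w => //; exists v => //; rewrite /= word_imageP.
by move: gt0; rewrite pmulr_rgt0 // -IH.
Qed.

End RandomSubstitution.

Section Subshift.
Variables (A : finType) (theta : substitution A).

Definition factor (x : int -> A) (i : int) (n : nat) : seq A :=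
  mkseq (fun j => x (i + j%:Z)) n.

Definition subshift : set (int -> A) :=
  [set x | forall (i : int) (n : nat), legal theta (factor x i n)].

(* shift k is the k-th power of the left shift. *)
Definition shift (k : int) (x : int -> A) : int -> A := fun i => x (i + k).

(* c j is the position at which the block v j starts. *)
Definition biinf_image (y : int -> A) : set (int -> A) :=
  [set x | exists (v : int -> seq A) (c : int -> int),
    [/\ forall j, v j \in theta (y j),
        c 0 = 0,
        forall j, c (j + 1) = c j + (size (v j))%:Z
      & forall j, factor x (c j) (size (v j)) = v j]].

Definition recognisable : Prop :=
  forall x, subshift x ->
    exists! yk : (int -> A) * nat,
      [/\ subshift yk.1, (yk.2 < image_size theta (yk.1 0%R))%N
        & biinf_image yk.1 (shift (- yk.2%:Z) x)].

(* The coordinates of a cylinder start at 1. *)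
Definition cylinder (v : seq A) : set (int -> A) :=
  [set x | subshift x /\ factor x 1 (size v) = v].

Definition central_cylinder (x : int -> A) (n : nat) : set (int -> A) :=
  [set y | subshift y /\ forall j : int, (`|j| <= n)%N -> y j = x j].

End Subshift.

Section Measures.
Variables (R : realType) (A : finType).

(* Measurable types are pointed in MathComp-Analysis: the letter a0 only serves
   to provide a point. *)
Definition full_shift (a0 : A) : Type :=
  prod_topology (fun _ : int => discrete_topology A).

Variable a0 : A.

HB.instance Definition _ := Topological.on (full_shift a0).
HB.instance Definition _ := isPointed.Build (full_shift a0) (fun _ => a0).

Definition borel_full_shift : Type := g_sigma_algebraType (@open (full_shift a0)).

HB.instance Definition _ := Measurable.on borel_full_shift.

Variable theta : substitution A.

(* The closed set X_theta need not be pointed, so Borel probability measures on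
   X_theta are given as those on the full shift that satisfy mu X_theta = 1. *)
Definition frequency_measure (P : A -> seq A -> R)
    (mu : probability borel_full_shift R) : Prop :=
  [/\ mu (subshift theta) = 1%E,
      forall B : set borel_full_shift, measurable B ->
        mu (shift 1 @^-1` B) = mu B
    & forall v, legal theta v -> forall a : A,
        (iter_mean theta P k [:: a] (fun w => (occ v w)%:R) /
         iter_mean theta P k [:: a] (fun w => (size w)%:R)) @[k --> \oo]
        --> fine (mu (cylinder theta v))].

(* Extended-real valued: lne 0 = -oo, whereas ln 0 = 0. *)
Definition local_dim_seq (mu : probability borel_full_shift R) (x : int -> A)
    (n : nat) : \bar R :=
  (- ((n.*2.+1%:R)^-1)%:E * lne (mu (central_cylinder theta x n)))%E.

Definition local_dim_exists (mu : probability borel_full_shift R) (x : int -> A)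
    : Prop := cvgn (local_dim_seq mu x).

Definition local_dim (mu : probability borel_full_shift R) (x : int -> A)
    : \bar R := limn (local_dim_seq mu x).

End Measures.

(* Main.v *)
(* Put [m_P w] for the mass of the cylinder of [w] under [muP] and let
   [Z N t] be the sum of [m_Q w * m_P w ^ t] over all words of length [N].
   Each occurrence of a word in an image of [u] comes from a block of letters of
   [u], so the masses at length [N] are controlled by those at length about
   [N / lam]. Integrating over the independent choices of images gives, for small
   [t] of either sign,
     [Z N t ~ Z (N / lam) t * exp (- (t H + o(t)) N / lam)],
   where [H] is the sum over [a] of [r a] times the cross entropy at [a]; the
   number of factors of each type is deterministic up to [o(N)] because
   compatible primitive substitutions have uniform letter frequencies. For
   [t < 0] only a lower bound on [m_P] is needed and this holds for every
   substitution. For [t > 0] an upper bound is needed, and there recognisability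
   (made local by compactness) says that the inner part of the preimage block is
   determined by the word. Iterating the recursion, [Z N t] grows at rate
   [- t H / (lam - 1) + o(t)], and Chernoff bounds with the Borel-Cantelli lemma
   give the almost sure limit without any ergodic theorem. *)
Require Import Defs.
From mathcomp Require Import all_boot all_order all_algebra.
From mathcomp Require Import finmap complex.
From mathcomp Require Import all_classical all_reals all_analysis.
From mathcomp Require Import ring lra zify.
Import Order.TTheory GRing.Theory Num.Theory.
Import numFieldNormedType.Exports.
Local Open Scope classical_set_scope.
Local Open Scope ring_scope.

Set Implicit Arguments.
Unset Strict Implicit.
Unset Printing Implicit Defensive.

(* [all_analysis] shadows these two names. *)
Local Notation factor := Defs.factor.
Local Notation shift := Defs.shift.

(** * Images of words *)

Section Words.
Variables (A : finType) (theta : substitution A).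

(** The measures themselves stay out of the main argument. It rests on [word_frequency], a statement
    about limits of mean occurrence counts: each inequality between masses is an inequality between
    counts after one image step, averaged and passed to the limit. Boundary terms vanish in the
    limit, and bounded factors do not matter at exponential scale. The two signs of [t] need
    different preimage blocks. For [t < 0] a word of length [N] is covered by the image of slightly
    more than [N / lam] letters; for [t > 0] it contains the image of slightly fewer, and the
    letters left over are counted crudely. Both discrepancies are a small fraction of [N] and cost a
    factor [expR (d * N)] with [d] arbitrarily small. The growth rate is needed only to first order
    at [t = 0]: the mean of [P a s] to the power [t] under [Q] is [1 - t * cross_entropy] up to
    [O(t ^ 2)]. Small positive and negative [t] then control the two tails around the same value. *)

Lemma word_image_consP a (u x : seq A) :
  reflect (exists s y, [/\ s \in theta a, y \in word_image theta u & x = s ++ y])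
          (x \in word_image theta (a :: u)).
Proof.
apply: (iffP idP) => [/imfset2P [s sa [y yu ->]]|[s [y [sa yu ->]]]].
  by exists s, y.
by apply/imfset2P; exists s => //; exists y.
Qed.

Lemma word_image_nil (x : seq A) : (x \in word_image theta [::]) = (x == [::]).
Proof. by rewrite in_fset1. Qed.

Lemma word_image_catP (u v x : seq A) :
  reflect (exists y z, [/\ y \in word_image theta u, z \in word_image theta v
                         & x = y ++ z])
          (x \in word_image theta (u ++ v)).
Proof.
apply: (iffP idP).
  elim: u x => [|a u IH] x; first by exists [::], x; rewrite word_image_nil.
  rewrite cat_cons => /word_image_consP [s [w [sa /IH [y [z [yu zv ->]]] ->]]].
  exists (s ++ y), z; split=> //; last by rewrite catA.
  by apply/word_image_consP; exists s, y.
elim: u x => [|a u IH] x [y [z []]].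
  by rewrite word_image_nil => /eqP -> zv ->.
move=> /word_image_consP [s [y' [sa yu ->]]] zv ->.
rewrite cat_cons; apply/word_image_consP; exists s, (y' ++ z).
by split=> //; [apply: IH; exists y', z | rewrite catA].
Qed.

Lemma image_rep_in a : image_rep theta a \in theta a.
Proof.
have := subst_neq0 theta a; rewrite /image_rep.
case: fset0Pn => // -[s sa] _.
have : s \in (theta a : seq _) by [].
move=> {}sa; suff : head [::] (theta a) \in (theta a : seq _) by [].
by case: (theta a : seq _) sa => //= z l _; rewrite mem_head.
Qed.

Lemma word_image_neq0 u : exists x, x \in word_image theta u.
Proof.
elim: u => [|a u [y yu]]; first by exists [::]; rewrite word_image_nil.
exists (image_rep theta a ++ y); apply/word_image_consP.
by exists (image_rep theta a), y; rewrite image_rep_in.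
Qed.

Lemma iter_imageSP k (u x : seq A) :
  reflect (exists2 w, w \in iter_image theta k u & x \in word_image theta w)
          (x \in iter_image theta k.+1 u).
Proof.
apply: (iffP idP) => [/imfset2P [w wk [v vw ->]]|[w wk xw]]; first by exists w.
by apply/imfset2P; exists w => //; exists x.
Qed.

Lemma iter_imageDP j k (u x : seq A) :
  reflect (exists2 w, w \in iter_image theta j u & x \in iter_image theta k w)
          (x \in iter_image theta (k + j) u).
Proof.
apply: (iffP idP).
  elim: k x => [|k IH] x; first by rewrite add0n => xu; exists x; rewrite ?in_fset1.
  rewrite addSn => /iter_imageSP [w /IH [v vj wk] xw].
  by exists v => //; apply/iter_imageSP; exists w.
elim: k x => [|k IH] x [w wj]; first by rewrite in_fset1 => /eqP ->.
move=> /iter_imageSP [v vk xv]; rewrite addSn; apply/iter_imageSP.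
by exists v => //; apply: IH; exists w.
Qed.

Lemma iter_image_cons k a (u x : seq A) : x \in iter_image theta k (a :: u) ->
  exists y z, [/\ y \in iter_image theta k [:: a], z \in iter_image theta k u
                & x = y ++ z].
Proof.
elim: k x => [|k IH] x.
  by rewrite in_fset1 => /eqP ->; exists [:: a], u; rewrite !in_fset1.
move=> /iter_imageSP [w /IH [y [z [yk zk ->]]] /word_image_catP].
move=> [y' [z' [yy zz ->]]]; exists y', z'.
by split=> //; apply/iter_imageSP; [exists y | exists z].
Qed.

Lemma iter_image_nil k (x : seq A) : x \in iter_image theta k [::] -> x = [::].
Proof.
elim: k x => [|k IH] x; first by rewrite in_fset1 => /eqP.
by move=> /iter_imageSP [w /IH ->]; rewrite word_image_nil => /eqP.
Qed.

Lemma iter_image_neq0 k u : exists x, x \in iter_image theta k u.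
Proof.
elim: k => [|k [y yu]]; first by exists u; rewrite in_fset1.
have [x xy] := word_image_neq0 y.
by exists x; apply/iter_imageSP; exists y.
Qed.

Lemma legal_infix u v : infix u v -> legal theta v -> legal theta u.
Proof.
by move=> uv [k [a [w wk vw]]]; exists k, a, w => //; apply: infix_trans vw.
Qed.

Lemma legal_image (u x : seq A) : legal theta u -> x \in word_image theta u ->
  legal theta x.
Proof.
move=> [k [a [w wk /infixP [p [q wE]]]]] xu.
have [y yp] := word_image_neq0 p; have [z zq] := word_image_neq0 q.
exists k.+1, a, (y ++ x ++ z); last by apply/infixP; exists y, z.
apply/iter_imageSP; exists w => //; rewrite wE.
apply/word_image_catP; exists y, (x ++ z); split=> //.
by apply/word_image_catP; exists x, z.
Qed.

Lemma legal_iter k a (x : seq A) : x \in iter_image theta k [:: a] -> legal theta x.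
Proof. by move=> xk; exists k, a, x => //; exact: infix_refl. Qed.

Lemma legal_letter a : legal theta [:: a].
Proof. by apply: (@legal_iter 0%N a); rewrite in_fset1. Qed.

Lemma legal_take n u : legal theta u -> legal theta (take n u).
Proof. by apply: legal_infix; apply: prefixW; apply: prefix_take. Qed.

Lemma legal_drop n u : legal theta u -> legal theta (drop n u).
Proof. by apply: legal_infix; apply: suffixW; apply: suffix_drop. Qed.

Lemma legal_nil (a : A) : legal theta [::].
Proof. by rewrite -[[::]](take0 [:: a]); apply/legal_take/legal_letter. Qed.

Lemma size_count (s : seq A) : size s = (\sum_b count_mem b s)%N.
Proof.
elim: s => [|a s IH] /=; first by rewrite big1.
rewrite big_split /= -IH -[LHS]add1n; congr (_ + _)%N.
by rewrite (bigD1 a) //= eqxx big1 // => b /negPf; rewrite eq_sym => ->.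
Qed.

Hypothesis hcomp : compatible theta.

Lemma count_subst a b (s : seq A) : s \in theta a ->
  count_mem b s = image_count theta a b.
Proof. by move=> sa; apply: hcomp sa (image_rep_in a). Qed.

Lemma size_subst a (s : seq A) : s \in theta a -> size s = image_size theta a.
Proof.
move=> sa; rewrite size_count /image_size size_count.
by apply: eq_bigr => b _; rewrite (count_subst _ sa).
Qed.

Lemma image_size_gt0 a : (0 < image_size theta a)%N.
Proof.
rewrite lt0n; apply/eqP => /size0nil h.
by have := subst_nonempty theta a; rewrite -h image_rep_in.
Qed.

Lemma image_size_count a : image_size theta a = (\sum_b image_count theta a b)%N.
Proof. exact: size_count. Qed.

Definition image_len (u : seq A) : nat := \sum_(a <- u) image_size theta a.

Lemma image_len_cat u v : image_len (u ++ v) = (image_len u + image_len v)%N.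
Proof. by rewrite /image_len big_cat. Qed.

Lemma image_len_cons a u : image_len (a :: u) = (image_size theta a + image_len
  u)%N.
Proof. by rewrite /image_len big_cons. Qed.

Lemma size_word_image (u x : seq A) : x \in word_image theta u ->
  size x = image_len u.
Proof.
elim: u x => [|a u IH] x.
  by rewrite word_image_nil => /eqP ->; rewrite /image_len big_nil.
move=> /word_image_consP [s [y [sa yu ->]]].
by rewrite size_cat (size_subst sa) (IH _ yu) image_len_cons.
Qed.

Lemma count_word_image b (u x : seq A) : x \in word_image theta u ->
  count_mem b x = (\sum_(a <- u) image_count theta a b)%N.
Proof.
elim: u x => [|a u IH] x; first by rewrite word_image_nil big_nil => /eqP ->.
move=> /word_image_consP [s [y [sa yu ->]]].
by rewrite count_cat (count_subst _ sa) (IH _ yu) big_cons.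
Qed.

Lemma size_le_image_len u : (size u <= image_len u)%N.
Proof.
elim: u => // a u IH; rewrite image_len_cons -[(size _)%N]add1n.
by rewrite leq_add // image_size_gt0.
Qed.

Definition max_size : nat := \max_a image_size theta a.

Lemma leq_max_size a : (image_size theta a <= max_size)%N.
Proof. exact: leq_bigmax. Qed.

Lemma image_len_le u : (image_len u <= max_size * size u)%N.
Proof.
elim: u => [|a u IH]; first by rewrite /image_len big_nil.
by rewrite image_len_cons mulnS leq_add // leq_max_size.
Qed.

End Words.

(** * Uniform letter frequencies *)

Section LetterFrequencies.
Variables (R : realType) (A : finType) (theta : substitution A).

(** Entries of the matrix power kept in [nat] and indexed by letters, so that a positive entry is at
    least 1. For compatible [theta] this is the number of [a] in every [k]-step image of [b]. *)
Fixpoint iter_count (k : nat) (a b : A) : nat :=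
  if k is k'.+1 then (\sum_c image_count theta c a * iter_count k' c b)%N
  else (a == b).

Lemma subst_matrix_exp k (i j : 'I_#|A|) :
  (subst_matrix theta R ^+ k) i j =
  (iter_count k (enum_val i) (enum_val j))%:R.
Proof.
elim: k i j => [|k IH] i j.
  by rewrite expr0 mxE /= (inj_eq enum_val_inj).
rewrite exprS -mulmxE mxE /= natr_sum (@big_enum_val _ _ _ _ A) /=.
by apply: eq_bigr => l _; rewrite IH mxE natrM.
Qed.

Lemma iter_countD j k a b :
  iter_count (j + k) a b = (\sum_c iter_count j a c * iter_count k c b)%N.
Proof.
elim: j a => [|j IH] a /=.
  rewrite (bigD1 a) //= eqxx mul1n big1 ?addn0 // => c.
  by rewrite eq_sym => /negPf ->.
under eq_bigr do rewrite IH big_distrr /=.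
rewrite exchange_big /=; apply: eq_bigr => c _.
by rewrite big_distrl /=; apply: eq_bigr => d _; rewrite mulnA.
Qed.

Hypothesis hcomp : compatible theta.

Lemma sum_count (V : nmodType) (f : A -> V) (u : seq A) :
  \sum_(a <- u) f a = \sum_a f a *+ count_mem a u.
Proof.
elim: u => [|b u IH]; first by rewrite big_nil big1.
rewrite big_cons IH (bigD1 b) //= [in RHS](bigD1 b) //= eqxx mulrnDr mulr1n.
rewrite addrA; congr (_ + _); apply: eq_bigr => a.
by rewrite eq_sym => /negPf ->.
Qed.

Lemma count_iter_image k a (u x : seq A) : x \in iter_image theta k u ->
  count_mem a x = (\sum_(b <- u) iter_count k a b)%N.
Proof.
elim: k a x => [|k IH] a x.
  rewrite in_fset1 => /eqP ->; rewrite -sum1_count big_mkcond /=.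
  by apply: eq_bigr => b _; rewrite eq_sym; case: eqP.
move=> /iter_imageSP [w wk xw]; rewrite (count_word_image hcomp _ xw) /=.
rewrite sum_count exchange_big /=; apply: eq_bigr => c _.
by rewrite -mulr_natr natn (IH _ _ wk) big_distrr.
Qed.

Definition iter_len k b := (\sum_a iter_count k a b)%N.

Lemma size_iter_image k b (x : seq A) : x \in iter_image theta k [:: b] ->
  size x = iter_len k b.
Proof.
move=> xk; rewrite size_count; apply: eq_bigr => a _.
by rewrite (count_iter_image _ xk) big_seq1.
Qed.

Hypothesis hprim : subst_primitive R theta.
Variables (lam : R) (r : A -> R).
Hypotheses (hlam : PF_eigenvalue theta lam)
  (hr : PF_right_eigenvector theta lam r).

(** Primitivity supplies some Perron--Frobenius eigenvalue above 1. It stays an eigenvalue over the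
    complex numbers, so the given [lam] dominates it. *)
Lemma PF_eigenvalue_gt1 : 1 < lam.
Proof.
have [_ [l [hl _] l1]] := hprim; apply: lt_le_trans l1 _.
have [_ hmax] := hlam.
have : eigenvalue (subst_matrix theta R[i]) (l%:C)%C.
  have -> : subst_matrix theta R[i] =
            map_mx (real_complex R) (subst_matrix theta R).
    by apply/matrixP => i j; rewrite !mxE rmorph_nat.
  by rewrite eigenvalue_map.
move=> /hmax; rewrite normc_def /= expr0n addr0 sqrtr_sqr.
by rewrite lecR; apply: le_trans; rewrite ler_norm.
Qed.

Lemma PF_vector_gt0 a : 0 < r a. Proof. by case: hr => _ h _. Qed.

Lemma PF_vector_sum1 : \sum_a r a = 1. Proof. by case: hr. Qed.

Lemma PF_vector_le1 a : r a <= 1.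
Proof.
rewrite -PF_vector_sum1 (bigD1 a) //= lerDl sumr_ge0 // => b _.
exact/ltW/PF_vector_gt0.
Qed.

Lemma PF_vectorE a : \sum_b (image_count theta b a)%:R * r b = lam * r a.
Proof.
case: hr => /matrixP /(_ (enum_rank a) 0) + _ _.
rewrite !mxE !enum_rankK => <-; rewrite (@big_enum_val _ _ _ _ A) /=.
by apply: eq_bigr => i _; rewrite !mxE enum_rankK.
Qed.

Lemma iter_count_vectorE k a :
  \sum_b (iter_count k a b)%:R * r b = lam ^+ k * r a.
Proof.
elim: k a => [|k IH] a /=.
  rewrite (bigD1 a) //= eqxx big1 ?addr0 ?mul1r // => b.
  by rewrite eq_sym => /negPf ->; rewrite mul0r.
under eq_bigr do rewrite natr_sum mulr_suml.
rewrite exchange_big /= exprSr -mulrA -PF_vectorE mulr_sumr.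
apply: eq_bigr => c _; rewrite mulrCA -IH mulr_sumr.
by apply: eq_bigr => b _; rewrite natrM mulrA.
Qed.

(** Sum of the eigenvector equation over all letters. With the letter frequencies it shows that one
    step lengthens long legal words by the factor [lam]. *)
Lemma PF_eigenvalueE : lam = \sum_a r a * (image_size theta a)%:R.
Proof.
transitivity (lam * \sum_a r a); first by rewrite PF_vector_sum1 mulr1.
rewrite mulr_sumr; under eq_bigr do rewrite -PF_vectorE.
rewrite exchange_big /=; apply: eq_bigr => b _.
by rewrite image_size_count natr_sum mulr_sumr; under eq_bigr do rewrite mulrC.
Qed.

Lemma finite_pos_lbound (f : A -> R) : (forall a, 0 < f a) ->
  exists2 rho, 0 < rho & forall a, rho <= f a.
Proof.
move=> f0; have s0 : 0 <= \sum_a (f a)^-1.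
  by apply: sumr_ge0 => a _; rewrite invr_ge0 ltW.
(* Unlike a minimum, this value makes sense for an empty alphabet too. *)
exists (1 + \sum_a (f a)^-1)^-1; first by rewrite invr_gt0 ltr_wpDr.
move=> a; rewrite -[leRHS]invrK lef_pV2 ?posrE ?invr_gt0 ?ltr_wpDr //.
rewrite (bigD1 a) //= addrCA lerDl addr_ge0 // sumr_ge0 // => b _.
by rewrite invr_ge0 ltW.
Qed.

Lemma iter_count_pos : exists2 k, (0 < k)%N & forall a b, (0 < iter_count k a b)%N.
Proof.
have [[k k0 hk] _] := hprim; exists k => // a b.
have := hk (enum_rank a) (enum_rank b).
by rewrite subst_matrix_exp !enum_rankK ltr0n.
Qed.

(** After [K] steps every column dominates the eigenvector, since [r c <= 1 <= iter_count K c b];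
    the other [k] steps multiply the eigenvector by [lam ^+ k]. *)
Lemma iter_len_ge : exists K, forall k b, lam ^+ k <= (iter_len (k + K) b)%:R.
Proof.
have [K K0 hK] := iter_count_pos; exists K => k b.
have -> : lam ^+ k = \sum_a lam ^+ k * r a.
  by rewrite -mulr_sumr PF_vector_sum1 mulr1.
rewrite /iter_len natr_sum.
apply: ler_sum => a _; rewrite -iter_count_vectorE iter_countD natr_sum.
apply: ler_sum => c _; rewrite natrM ler_wpM2l ?ler0n //.
by rewrite (le_trans (PF_vector_le1 c)) // ler1n.
Qed.

(* Birkhoff contraction: after division by the eigenvector, [K] steps of the
   matrix act as averaging with weights bounded below, so the oscillation of a
   column shrinks geometrically. *)
Lemma column_oscillation (a0 : A) (K : nat) (d D : R) :
  (forall a b, 1 <= (iter_count K a b)%:R :> R) ->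
  (forall a b, (iter_count K a b)%:R <= D * r a) ->
  0 < d -> (forall a, d * lam ^+ K <= r a) ->
  forall j b, exists lo hi : R,
    [/\ 1 <= lo, hi - lo <= (1 - d) ^+ j * D &
      forall a, lo * lam ^+ (K * j) * r a <= (iter_count (K * j.+1) a b)%:R
                <= hi * lam ^+ (K * j) * r a].
Proof.
move=> ge1 leD d0 hd; elim=> [|j IH] b.
  exists 1, D; rewrite muln0 muln1 !expr0 !mulr1 !mul1r; split=> //.
    by rewrite gerBl.
  move=> a; rewrite leD andbT mul1r.
  by rewrite (le_trans (PF_vector_le1 a)).
have [lo [hi [lo1 hilo hb]]] := IH b.
set s := lam ^+ (K * j) in hb.
have lam0 : 0 < lam by apply: lt_trans PF_eigenvalue_gt1.
have s0 : 0 < s by rewrite exprn_gt0.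
set x := fun c => (iter_count (K * j.+1) c b)%:R : R.
(* Only the normalised entry [g] at [a0] is followed: [lo] and [hi] each move towards [g] by the
   fraction [d] of their distance, which shortens the interval by the factor [1 - d]. *)
have [g xa0] : exists g, x a0 = g * s * r a0.
  exists (x a0 / (s * r a0)); rewrite -mulrA mulfVK // mulf_neq0 // gt_eqF //.
  exact: PF_vector_gt0.
have sr0 : 0 < s * r a0 by rewrite mulr_gt0 // PF_vector_gt0.
have /andP[log ghi] : lo <= g <= hi.
  by have := hb a0; rewrite -/(x a0) xa0 -!mulrA !(ler_pM2r sr0).
exists (lo + d * (g - lo)), (hi - d * (hi - g)); split.
- by rewrite (le_trans lo1) // lerDl mulr_ge0 ?subr_ge0 // ltW.
- have -> : hi - d * (hi - g) - (lo + d * (g - lo)) = (1 - d) * (hi - lo) by ring.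
  rewrite exprS -mulrA ler_wpM2l // subr_ge0.
  have := hd a0; have := PF_vector_le1 a0.
  have : 1 <= lam ^+ K by rewrite exprn_ege1 // ltW // PF_eigenvalue_gt1.
  move: (lam ^+ K) (r a0) => L ra L1 ra1 dL.
  apply: le_trans (le_trans dL ra1); rewrite ler_peMr //; exact: ltW.
move=> a; rewrite [(K * j.+2)%N]mulnS iter_countD natr_sum.
have -> : \sum_c (iter_count K a c * iter_count (K * j.+1) c b)%:R
  = \sum_c (iter_count K a c)%:R * x c :> R.
  by apply: eq_bigr => c _; rewrite natrM.
rewrite mulnS exprD -/s.
(* In each row the letter [a0] carries at least the fraction [d] of the total weight
   [lam ^+ K * r a]. *)
have key : d * lam ^+ K * r a <= (iter_count K a a0)%:R * r a0.
  apply: (@le_trans _ _ (d * lam ^+ K)).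
    rewrite ler_piMr ?PF_vector_le1 // mulr_ge0 ?exprn_ge0 // ltW //.
  apply: le_trans (hd a0) _; rewrite ler_peMl //; exact/ltW/PF_vector_gt0.
have sumE y : \sum_c (iter_count K a c)%:R * (y * s * r c)
    = y * s * (lam ^+ K * r a).
  rewrite -iter_count_vectorE mulr_sumr; apply: eq_bigr => c _.
  by rewrite mulrCA.
apply/andP; split.
- have -> : (lo + d * (g - lo)) * (lam ^+ K * s) * r a =
    lo * s * (lam ^+ K * r a) + (g - lo) * s * (d * lam ^+ K * r a) by ring.
  apply: (@le_trans _ _ (lo * s * (lam ^+ K * r a) +
      (g - lo) * s * ((iter_count K a a0)%:R * r a0))).
    by rewrite lerD2l ler_wpM2l // mulr_ge0 ?subr_ge0 // ltW.
  rewrite -sumE [X in X + _ <= _](bigD1 a0) //= [leRHS](bigD1 a0) //= addrAC lerD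
    //.
    by rewrite xa0 -subr_ge0 le_eqVlt; apply/orP; left; apply/eqP; ring.
  apply: ler_sum => c _; rewrite ler_wpM2l //.
  by have /andP[] := hb c.
- have -> : (hi - d * (hi - g)) * (lam ^+ K * s) * r a =
    hi * s * (lam ^+ K * r a) - (hi - g) * s * (d * lam ^+ K * r a) by ring.
  apply: (@le_trans _ _ (hi * s * (lam ^+ K * r a) -
      (hi - g) * s * ((iter_count K a a0)%:R * r a0))); last first.
    by rewrite lerD2l lerN2 ler_wpM2l // mulr_ge0 ?subr_ge0 // ltW.
  rewrite -sumE [leLHS](bigD1 a0) //= [X in _ <= X - _](bigD1 a0) //=.
  rewrite [leRHS]addrAC lerD //.
    by rewrite xa0 -subr_ge0 le_eqVlt; apply/orP; left; apply/eqP; ring.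
  apply: ler_sum => c _; rewrite ler_wpM2l //.
  by have /andP[] := hb c.
Qed.

Lemma pow_le_eps (q D eps : R) : 0 <= q -> q < 1 -> 0 < eps ->
  exists j, q ^+ j * D <= eps.
Proof.
move=> q0 q1 e0.
have : q ^+ j * D @[j --> \oo] --> 0 * D.
  by apply: cvgMr_tmp; apply: cvg_expr; rewrite ger0_norm.
rewrite mul0r => /cvgr0Pnorm_le /(_ eps e0) [N _ /(_ N (leqnn N))] h.
by exists N; apply: le_trans h; rewrite ler_norm.
Qed.

(** Since [r] sums to 1, the column length lies between the same multiples [lo * s] and [hi * s] as
    the normalised entries. An entry thus differs from its share of the length by at most the
    oscillation, and [1 <= lo] turns this into a relative error. *)
Lemma iter_count_frequency (a0 : A) (eps : R) : 0 < eps -> exists k, forall a b,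
  `|(iter_count k a b)%:R - r a * (iter_len k b)%:R| <= eps * (iter_len k b)%:R.
Proof.
move=> e0.
have [K K0 hK] := iter_count_pos.
have [rho rho0 hrho] := finite_pos_lbound PF_vector_gt0.
have lamK0 : 0 < lam ^+ K by rewrite exprn_gt0 // (lt_trans _ PF_eigenvalue_gt1).
have lamK1 : 1 <= lam ^+ K by rewrite exprn_ege1 // ltW // PF_eigenvalue_gt1.
pose d := rho / lam ^+ K.
have d0 : 0 < d by rewrite divr_gt0.
have d1 : d <= 1.
  rewrite ler_pdivrMr // mul1r (le_trans _ lamK1) //.
  by rewrite (le_trans (hrho a0)) // PF_vector_le1.
pose D := \sum_a \sum_b (iter_count K a b)%:R / rho.
have [j hj] := @pow_le_eps (1 - d) D eps ltac:(by rewrite subr_ge0)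
  ltac:(by rewrite gtrBl) e0.
exists (K * j.+1)%N => a b.
have ge1 c e : 1 <= (iter_count K c e)%:R :> R by rewrite ler1n.
have leD c e : (iter_count K c e)%:R <= D * r c.
  have D0 x y : 0 <= (iter_count K x y)%:R / rho.
    by rewrite divr_ge0 // ltW.
  apply: (@le_trans _ _ ((iter_count K c e)%:R / rho * r c)).
    by rewrite mulrAC ler_pdivlMr // ler_wpM2l.
  rewrite ler_wpM2r //; first exact/ltW/PF_vector_gt0.
  rewrite /D (bigD1 c) //= (bigD1 e) //= -addrA lerDl addr_ge0 ?sumr_ge0 //.
  by move=> x _; rewrite sumr_ge0.
have hd c : d * lam ^+ K <= r c by rewrite mulfVK ?gt_eqF.
have [lo [hi [lo1 hilo hb]]] := column_oscillation a0 ge1 leD d0 hd j b.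
have s0 : 0 < lam ^+ (K * j) by rewrite exprn_gt0 // (lt_trans _ PF_eigenvalue_gt1).
move: hb; set s := lam ^+ (K * j) in s0 *; set k := (K * j.+1)%N => hb.
have sumr x : x = \sum_c x * r c by rewrite -mulr_sumr PF_vector_sum1 mulr1.
have L1 : lo * s <= (iter_len k b)%:R.
  rewrite [leLHS]sumr natr_sum ler_sum // => c _.
  by have /andP[] := hb c.
have L2 : (iter_len k b)%:R <= hi * s.
  rewrite [leRHS]sumr natr_sum ler_sum // => c _.
  by have /andP[] := hb c.
have /andP[b1 b2] := hb a.
have ra0 := PF_vector_gt0 a.
apply: (@le_trans _ _ (r a * (hi * s - lo * s))).
  rewrite ler_norml; apply/andP; split.
    rewrite -subr_ge0 (_ : _ - _ = (iter_count k a b)%:R - lo * s * r a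
      + r a * (hi * s - (iter_len k b)%:R)); last by ring.
    by rewrite addr_ge0 ?subr_ge0 // mulr_ge0 ?subr_ge0 // ltW.
  rewrite -subr_ge0 (_ : _ - _ = hi * s * r a - (iter_count k a b)%:R
      + r a * ((iter_len k b)%:R - lo * s)); last by ring.
  by rewrite addr_ge0 ?subr_ge0 // mulr_ge0 ?subr_ge0 // ltW.
have hl0 : 0 <= hi * s - lo * s by rewrite subr_ge0 (le_trans L1).
apply: (@le_trans _ _ (hi * s - lo * s)).
  by rewrite ler_piMl ?PF_vector_le1.
rewrite -mulrBl; apply: (@le_trans _ _ (eps * s)).
  by rewrite ler_wpM2r ?(ltW s0) // (le_trans hilo).
rewrite ler_wpM2l ?(ltW e0) // (le_trans _ L1) // ler_peMl ?(ltW s0) //.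
Qed.

(** A subword of a [k]-step image consists of complete blocks and at most two cut ones, at its ends.
    Complete blocks contribute the [eps] term, each cut block at most [G * B]. *)
Lemma block_sum_bound (g : A -> R) (k B : nat) (G eps : R) : 0 <= eps ->
  0 <= G -> (forall a, `|g a| <= G) ->
  (forall b W, W \in iter_image theta k [:: b] ->
     `|\sum_(a <- W) g a| <= eps * (size W)%:R /\ (size W <= B)%N) ->
  forall u W p q, W \in iter_image theta k u ->
  `|\sum_(a <- take q (drop p W)) g a| <=
  eps * (size (take q (drop p W)))%:R + 2 * (G * B%:R).
Proof.
move=> e0 G0 hG hB.
have GB0 : 0 <= G * B%:R by rewrite mulr_ge0.
have short w : (size w <= B)%N -> `|\sum_(a <- w) g a| <= G * B%:R.
  move=> szw; apply: le_trans (ler_norm_sum _ _ _) _.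
  apply: (@le_trans _ _ (\sum_(a <- w) G)); first exact: ler_sum.
  by rewrite big_const_seq count_predT iter_addr_0 -[leLHS]mulr_natr ler_wpM2l
    ?ler_nat.
(* A prefix cuts a block only on the right; the outer induction then treats the left end. *)
have pre u W q : W \in iter_image theta k u ->
    `|\sum_(a <- take q W) g a| <= eps * (size (take q W))%:R + G * B%:R.
  elim: u W q => [|b u IH] W q.
    move=> /iter_image_nil ->; rewrite /= big_nil normr0 mulr0 add0r //.
  move=> /iter_image_cons [y [z [/hB [yb yB] zk ->]]].
  rewrite take_cat; case: ltnP => qy.
    rewrite ler_wpDl ?mulr_ge0 // short //.
    by rewrite size_take qy (leq_trans _ yB) // ltnW.
  rewrite big_cat size_cat natrD mulrDr /= -addrA.
  by apply: le_trans (ler_normD _ _) _; rewrite lerD // IH.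
elim=> [|b u IH] W p q.
  move=> /iter_image_nil ->; rewrite /= big_nil normr0 mulr0 add0r //.
  by rewrite mulr_ge0.
move=> /iter_image_cons [y [z [/hB [yb yB] zk ->]]].
rewrite drop_cat; case: ltnP => py; last exact: IH.
rewrite take_cat; case: ltnP => qy.
  rewrite ler_wpDl ?mulr_ge0 // (le_trans (short _ _)) //; last first.
    by rewrite ler_peMl // ler1n.
  by rewrite size_take qy (leq_trans (ltnW qy)) // size_drop (leq_trans (leq_subr _
    _)).
rewrite big_cat size_cat natrD mulrDr /=.
apply: le_trans (ler_normD _ _) _.
have h1 : `|\sum_(i <- drop p y) g i| <= G * B%:R.
  by rewrite short // size_drop (leq_trans (leq_subr _ _)).
have h2 := pre _ _ (q - size (drop p y))%N zk.
have h3 : 0 <= eps * (size (drop p y))%:R by rewrite mulr_ge0.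
lra.
Qed.

(** Words arising after at least [k] steps split into [k]-step blocks with nearly exact letter
    proportions; those arising earlier have bounded length and go into [C]. The function [f] is
    later an indicator, an image length and a cross entropy. *)
Lemma letter_frequency (a0 : A) (f : A -> R) (eps : R) : 0 < eps ->
  exists2 C, 0 <= C & forall w, legal theta w ->
  `|\sum_(a <- w) f a - (\sum_a r a * f a) * (size w)%:R| <=
  eps * (size w)%:R + C.
Proof.
move=> e0; pose F := \sum_a r a * f a; pose g a := f a - F.
have devE w : \sum_(a <- w) f a - F * (size w)%:R = \sum_(a <- w) g a.
  by rewrite sumrB big_const_seq count_predT iter_addr_0 mulr_natr.
pose S := \sum_a `|f a|; have S0 : 0 <= S by apply: sumr_ge0.
have [|k hk] := @iter_count_frequency a0 (eps / (S + 1)).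
  by rewrite divr_gt0 // ltr_wpDl.
pose G := \sum_a `|g a|; have G0 : 0 <= G by apply: sumr_ge0.
have hG a : `|g a| <= G.
  by rewrite /G (bigD1 a) //= lerDl sumr_ge0.
pose B := (\sum_b iter_len k b)%N.
pose B' := (\sum_(j < k) \sum_b iter_len j b)%N.
exists (2 * (G * B%:R) + G * B'%:R); first by rewrite addr_ge0 ?mulr_ge0.
move=> w [j [a [W Wj /infixP [p [q WE]]]]]; rewrite devE.
have wE : w = take (size w) (drop (size p) W).
  by rewrite WE drop_size_cat // take_size_cat.
have [kj|jk] := leqP k j.
  move: Wj; rewrite -(subnKC kj) => /iter_imageDP [u _ Wu].
  rewrite addrA ler_wpDr //; first by rewrite mulr_ge0.
  rewrite {1 2}wE; apply: block_sum_bound Wu => //; first exact: ltW.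
  move=> b V Vk; split; last first.
    by rewrite (size_iter_image Vk) /B (bigD1 b) //= leq_addr.
  rewrite -devE sum_count (size_iter_image Vk) /F mulr_suml -sumrB.
  apply: (@le_trans _ _ (\sum_c (eps / (S + 1) * (iter_len k b)%:R) * `|f c|)).
    apply: le_trans (ler_norm_sum _ _ _) _; apply: ler_sum => c _.
    rewrite (count_iter_image _ Vk) big_seq1 -[f c *+ _]mulr_natl [X in _ -
      X]mulrAC -mulrBl normrM.
    by rewrite ler_wpM2r.
  rewrite -mulr_sumr -/S mulrAC ler_wpM2r // -mulrA ler_piMr ?(ltW e0) //.
  by rewrite mulrC ler_pdivrMr ?ltr_wpDl // mul1r lerDl.
rewrite ler_wpDl ?mulr_ge0 ?(ltW e0) // ler_wpDl ?mulr_ge0 //.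
apply: le_trans (ler_norm_sum _ _ _) _.
apply: (@le_trans _ _ (\sum_(a <- w) G)); first exact: ler_sum.
rewrite big_const_seq count_predT iter_addr_0 -[leLHS]mulr_natr ler_wpM2l //
  ler_nat.
have : (size w <= size W)%N by rewrite WE !size_cat addnCA leq_addr.
move=> /leq_trans; apply; rewrite (size_iter_image Wj).
by rewrite /B' (bigD1 (Ordinal jk)) //= (bigD1 a) //= -addnA leq_addr.
Qed.

End LetterFrequencies.

(** * Expectations over random images *)

Section Expectation.
Variables (R : realType) (A : finType) (theta : substitution A).
Variable P : A -> seq A -> R.

Definition image_mean (u : seq A) (f : seq A -> R) : R :=
  \sum_(x <- word_image theta u) word_prob theta P u x * f x.

Hypothesis hP : permissible theta P.

Lemma word_prob_eq0 u x : x \notin word_image theta u -> word_prob theta P u x = 0.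
Proof.
rewrite (word_imageP hP) -leNgt => h.
by apply/eqP; rewrite eq_le h word_prob_ge0.
Qed.

Lemma permissible_ge0 a s : 0 <= P a s.
Proof.
have [pos zero _] := hP a.
by have [/pos/ltW|/zero ->] := boolP (s \in theta a).
Qed.

Lemma image_mean_nil f : image_mean [::] f = f [::].
Proof. by rewrite /image_mean /= big_seq_fset1 eqxx mul1r. Qed.

(** Different choices may concatenate to the same word, so the sum over words is regrouped by the
    first image [s]; for fixed [s], prepending it is injective. *)
Lemma image_mean_cons a u f : image_mean (a :: u) f =
  \sum_(s <- theta a) P a s * image_mean u (fun x => f (s ++ x)).
Proof.
rewrite /image_mean [word_prob _ _ _]/=.
under eq_bigr do rewrite mulr_suml big_mkcond /=.
rewrite exchange_big /= big_seq [RHS]big_seq; apply: eq_bigr => s sa.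
pose h := fun x : seq A => s ++ x.
have hinj : {in word_image theta u &, injective h}.
  by move=> x y _ _ /eqP; rewrite /h eqseq_cat // eqxx => /eqP.
pose F x := if prefix s x then
   P a s * word_prob theta P u (drop (size s) x) * f x else 0.
transitivity (\sum_(x <- (h @` word_image theta u)%fset) F x).
  symmetry; apply: big_fset_incl.
    apply/fsubsetP => x /imfsetP [y yu ->].
    by apply/word_image_consP; exists s, y.
  move=> x xau; rewrite /F; case: ifP => // /prefixP [y ->] xh.
  rewrite drop_size_cat // word_prob_eq0 ?mulr0 ?mul0r //.
  by apply: contra xh => yu; apply/imfsetP; exists y.
rewrite big_imfset //= mulr_sumr; apply: eq_bigr => y _.
by rewrite /F prefix_prefix drop_size_cat // mulrA.
Qed.

Lemma image_mean_le u f g : (forall x, x \in word_image theta u -> f x <= g x) ->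
  image_mean u f <= image_mean u g.
Proof.
move=> fg; rewrite /image_mean big_seq [leRHS]big_seq ler_sum // => x xu.
by rewrite ler_wpM2l ?word_prob_ge0 // fg.
Qed.

Lemma eq_image_mean u f g : (forall x, x \in word_image theta u -> f x = g x) ->
  image_mean u f = image_mean u g.
Proof.
move=> fg; rewrite /image_mean big_seq [RHS]big_seq; apply: eq_bigr => x xu.
by rewrite fg.
Qed.

Lemma image_meanZ c u f : image_mean u (fun x => c * f x) = c * image_mean u f.
Proof. by rewrite /image_mean mulr_sumr; apply: eq_bigr => x _; rewrite mulrCA. Qed.

Lemma image_mean_sum I (s : seq I) u (f : I -> seq A -> R) :
  image_mean u (fun x => \sum_(i <- s) f i x) = \sum_(i <- s) image_mean u (f i).
Proof.
by rewrite /image_mean exchange_big /=; apply: eq_bigr => x _; rewrite mulr_sumr.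
Qed.

Lemma image_mean_cst c u : image_mean u (fun=> c) = c.
Proof.
elim: u => [|a u IH]; first exact: image_mean_nil.
rewrite image_mean_cons; under eq_bigr do rewrite IH.
by rewrite -mulr_suml; have [_ _ ->] := hP a; rewrite mul1r.
Qed.

Lemma image_mean_ge0 u f : (forall x, x \in word_image theta u -> 0 <= f x) ->
  0 <= image_mean u f.
Proof. by move=> f0; rewrite -(image_mean_cst 0 u) image_mean_le. Qed.

Lemma image_mean_cat u v f :
  image_mean (u ++ v) f =
  image_mean u (fun x => image_mean v (fun y => f (x ++ y))).
Proof.
elim: u f => [|a u IH] f; first by rewrite image_mean_nil.
rewrite cat_cons !image_mean_cons; apply: eq_bigr => s _; rewrite IH.
congr (_ * _); apply: eq_image_mean => x _.
by apply: eq_image_mean => y _; rewrite catA.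
Qed.

Lemma word_prob_mean u x :
  word_prob theta P u x = image_mean u (fun y => (y == x)%:R).
Proof.
have [xu|xu] := boolP (x \in word_image theta u); last first.
  rewrite word_prob_eq0 // /image_mean big_seq big1 // => y yu.
  by case: eqP => [yx|_]; [rewrite -yx yu in xu | rewrite mulr0].
rewrite /image_mean (big_fsetD1 x) //= eqxx mulr1 big_seq big1 ?addr0 // => y.
by rewrite in_fsetD1 => /andP[/negPf -> _]; rewrite mulr0.
Qed.

Lemma iter_meanS k u f :
  iter_mean theta P k.+1 u f = iter_mean theta P k u (fun w => image_mean w f).
Proof.
rewrite /iter_mean [iter_prob _ _ _ _]/=; under eq_bigr do rewrite mulr_suml.
rewrite exchange_big /= big_seq [RHS]big_seq; apply: eq_bigr => w wk.
rewrite /image_mean mulr_sumr; symmetry.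
rewrite [LHS](eq_bigr (fun x =>
  iter_prob theta P k u w * word_prob theta P w x * f x)); last first.
  by move=> x _; rewrite mulrA.
apply: big_fset_incl.
  by apply/fsubsetP => x xw; apply/iter_imageSP; exists w.
by move=> x _ xw; rewrite word_prob_eq0 // mulr0 mul0r.
Qed.

Lemma iter_mean_le k u f g :
  (forall x, x \in iter_image theta k u -> f x <= g x) ->
  iter_mean theta P k u f <= iter_mean theta P k u g.
Proof.
move=> fg; rewrite /iter_mean big_seq [leRHS]big_seq ler_sum // => x xu.
by rewrite ler_wpM2l ?iter_prob_ge0 // fg.
Qed.

Lemma eq_iter_mean k u f g :
  (forall x, x \in iter_image theta k u -> f x = g x) ->
  iter_mean theta P k u f = iter_mean theta P k u g.
Proof.
move=> fg; rewrite /iter_mean big_seq [RHS]big_seq; apply: eq_bigr => x xu.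
by rewrite fg.
Qed.

Lemma iter_meanZ c k u f :
  iter_mean theta P k u (fun x => c * f x) = c * iter_mean theta P k u f.
Proof. by rewrite /iter_mean mulr_sumr; apply: eq_bigr => x _; rewrite mulrCA. Qed.

Lemma iter_meanD k u f g :
  iter_mean theta P k u (fun x => f x + g x) =
  iter_mean theta P k u f + iter_mean theta P k u g.
Proof. by rewrite /iter_mean -big_split; apply: eq_bigr => x _; rewrite mulrDr. Qed.

Lemma iter_mean_sum I (s : seq I) k u (f : I -> seq A -> R) :
  iter_mean theta P k u (fun x => \sum_(i <- s) f i x) =
  \sum_(i <- s) iter_mean theta P k u (f i).
Proof.
by rewrite /iter_mean exchange_big /=; apply: eq_bigr => x _; rewrite mulr_sumr.
Qed.

Lemma iter_mean_cst k u c : iter_mean theta P k u (fun=> c) = c.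
Proof.
elim: k => [|k IH]; first by rewrite /iter_mean /= big_seq_fset1 eqxx mul1r.
rewrite iter_meanS -[RHS]IH.
by apply: eq_iter_mean => x _; rewrite image_mean_cst.
Qed.

Hypothesis hcomp : compatible theta.

Lemma iter_mean_size k a :
  iter_mean theta P k [:: a] (fun w => (size w)%:R) = (iter_len theta k a)%:R.
Proof.
rewrite -[RHS](iter_mean_cst k [:: a]); apply: eq_iter_mean => x xk.
by rewrite (size_iter_image hcomp xk).
Qed.

Lemma iter_len_leS k a : (iter_len theta k a <= iter_len theta k.+1 a)%N.
Proof.
have [x xk] := iter_image_neq0 theta k [:: a].
have [y yx] := word_image_neq0 theta x.
have yk : y \in iter_image theta k.+1 [:: a] by apply/iter_imageSP; exists x.
rewrite -(size_iter_image hcomp xk) -(size_iter_image hcomp yk).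
by rewrite (size_word_image hcomp yx) size_le_image_len.
Qed.

Lemma iter_lenS_le k a :
  (iter_len theta k.+1 a <= max_size theta * iter_len theta k a)%N.
Proof.
have [x xk] := iter_image_neq0 theta k [:: a].
have [y yx] := word_image_neq0 theta x.
have yk : y \in iter_image theta k.+1 [:: a] by apply/iter_imageSP; exists x.
rewrite -(size_iter_image hcomp xk) -(size_iter_image hcomp yk).
by rewrite (size_word_image hcomp yx) image_len_le.
Qed.

Lemma occ_cons (v : seq A) a u : occ v (a :: u) = (prefix v (a :: u) + occ v u)%N.
Proof.
rewrite /occ /= -[1%N]addn0 iotaDl count_map; congr (_ + _)%N.
Qed.

Lemma occ_gt0_infix (v u : seq A) : (0 < occ v u)%N -> infix v u.
Proof.
rewrite /occ -has_count => /hasP [i _ /prefixP [w E]].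
by apply/infixP; exists (take i u), w; rewrite -E cat_take_drop.
Qed.

Lemma occ_illegal (v u : seq A) : legal theta u -> ~ legal theta v -> occ v u = 0%N.
Proof.
move=> lu nlv; apply/eqP; rewrite -leqn0 leqNgt; apply/negP => /occ_gt0_infix.
by move=> /legal_infix /(_ lu).
Qed.

Lemma occ_size (v u : seq A) : (occ v u <= size u)%N.
Proof. by rewrite /occ (leq_trans (count_size _ _)) // size_iota. Qed.

End Expectation.

(** * Masses as limits of mean occurrence counts *)

Section Frequencies.
Variables (R : realType) (A : finType) (a0 : A) (theta : substitution A).
Hypotheses (hprim : subst_primitive R theta) (hcomp : compatible theta).
Variables (lam : R) (r : A -> R).
Hypotheses (hlam : PF_eigenvalue theta lam)
  (hr : PF_right_eigenvector theta lam r).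
Variables (P : A -> seq A -> R) (m : seq A -> R).
Hypothesis hP : permissible theta P.

(** The interface between the measures and the combinatorics. One starting letter suffices, but
    illegal words are included, so that sums may run over all words of a given length. *)
Definition word_frequency : Prop := forall v,
  (iter_mean theta P k [:: a0] (fun w => (occ v w)%:R) /
   iter_mean theta P k [:: a0] (fun w => (size w)%:R)) @[k --> \oo] --> m v.

Hypothesis hm : word_frequency.

Let L k : R := (iter_len theta k a0)%:R.

Lemma iter_len_gt0 k : 0 < L k.
Proof.
rewrite ltr0n; elim: k => [|k IH]; last first.
  exact: leq_trans IH (iter_len_leS hcomp k a0).
by rewrite /iter_len /= (bigD1 a0) //= eqxx.
Qed.

Lemma inv_iter_len_cvg0 : (L k)^-1 @[k --> \oo] --> 0.
Proof.
have [K hK] := iter_len_ge hprim hr.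
have l1 := PF_eigenvalue_gt1 hprim hlam.
have l0 : 0 < lam by apply: lt_trans l1.
rewrite -(cvg_shiftn K).
apply: (@squeeze_cvgr _ _ _ _ (fun=> 0) (fun k => lam^-1 ^+ k)).
- near=> k; rewrite invr_ge0 ltW ?iter_len_gt0 //=.
  rewrite exprVn lef_pV2 ?posrE ?iter_len_gt0 ?exprn_gt0 //; exact: hK.
- exact: cvg_cst.
- apply: cvg_expr; rewrite ger0_norm ?invr_ge0 ?ltW //.
  by rewrite invf_lt1.
Unshelve. all: by end_near.
Qed.

Let ratio v k : R := iter_mean theta P k [:: a0] (fun w => (occ v w)%:R) / L k.

Lemma ratio_cvg v : ratio v k @[k --> \oo] --> m v.
Proof.
have := @hm v; under eq_fun do rewrite (iter_mean_size hP hcomp).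
exact.
Qed.

Lemma iter_mean_occ_ge0 k v :
  0 <= iter_mean theta P k [:: a0] (fun w => (occ v w)%:R).
Proof.
rewrite -(iter_mean_cst hP k [:: a0] 0); apply: iter_mean_le => // x _.
Qed.

Lemma frequency_ge0 v : 0 <= m v.
Proof.
have h0 : (0 : R) @[k --> \oo] --> (0 : R) by exact: cvg_cst.
apply: (ler_cvg_to h0 (@ratio_cvg v)).
near=> k; rewrite divr_ge0 ?iter_mean_occ_ge0 ?(ltW (iter_len_gt0 _)) //.
Unshelve. all: by end_near.
Qed.

Lemma cvg_bigsum I (s : seq I) (f : I -> nat -> R) (l : I -> R) :
  (forall i, f i k @[k --> \oo] --> l i) ->
  (\sum_(i <- s) f i k) @[k --> \oo] --> \sum_(i <- s) l i.
Proof.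
move=> h; elim: s => [|i s IH].
  by rewrite big_nil; under eq_fun do rewrite big_nil; exact: cvg_cst.
rewrite big_cons; under eq_fun do rewrite big_cons.
exact: cvgD.
Qed.

(** The one-step inequality is averaged over [k]-step words and divided by their length; [C]
    disappears because that length tends to infinity. *)
Lemma frequency_le I (s : seq I) (c : I -> R) (v : I -> seq A) (w : seq A) (C : R) :
  (forall u, legal theta u -> image_mean theta P u (fun x => (occ w x)%:R) <=
     \sum_(i <- s) c i * (occ (v i) u)%:R + C) ->
  m w <= \sum_(i <- s) c i * m (v i).
Proof.
move=> h.
have h1 : ratio w k.+1 @[k --> \oo] --> m w.
  by have := @ratio_cvg w; rewrite -cvg_shiftS.
have h2 : (\sum_(i <- s) c i * ratio (v i) k + C * (L k)^-1) @[k --> \oo] -->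
    \sum_(i <- s) c i * m (v i) + C * 0.
  apply: cvgD; last by apply: cvgMl_tmp; exact: inv_iter_len_cvg0.
  by apply: cvg_bigsum => i; apply: cvgMl_tmp; exact: ratio_cvg.
rewrite mulr0 addr0 in h2; apply: (ler_cvg_to h1 h2); near=> k.
rewrite /ratio; set N := iter_mean _ _ _ _ _.
have N0 : 0 <= N by apply: iter_mean_occ_ge0.
(* Dividing by the shorter length [L k] gives up a factor close to [lam], harmless at exponential
   scale. *)
apply: (@le_trans _ _ (N / L k)).
  rewrite ler_wpM2l // lef_pV2 ?posrE ?iter_len_gt0 // ler_nat.
  exact: iter_len_leS.
have -> : \sum_(i <- s) c i * ratio (v i) k + C / L k = (\sum_(i <- s)
    c i * iter_mean theta P k [:: a0] (fun x => (occ (v i) x)%:R) + C) / L k.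
  rewrite mulrDl mulr_suml; congr (_ + _).
  by apply: eq_bigr => i _; rewrite mulrA.
rewrite ler_wpM2r ?invr_ge0 ?(ltW (iter_len_gt0 _)) //.
rewrite /N iter_meanS // -(iter_mean_cst hP k [:: a0] C).
under eq_bigr do rewrite -iter_meanZ.
rewrite -iter_mean_sum -iter_meanD; apply: iter_mean_le => // x xk.
by apply: h; exact: legal_iter xk.
Unshelve. all: by end_near.
Qed.

Lemma max_size_gt0 : (0 < max_size theta)%N.
Proof. exact: leq_trans (image_size_gt0 theta a0) (leq_max_size theta a0). Qed.

Lemma frequency_ge (c : R) (v w : seq A) : 0 <= c ->
  (forall u, legal theta u ->
     c * (occ v u)%:R <= image_mean theta P u (fun x => (occ w x)%:R)) ->
  c / (max_size theta)%:R * m v <= m w.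
Proof.
move=> c0 h.
have h1 : ratio w k.+1 @[k --> \oo] --> m w.
  by have := @ratio_cvg w; rewrite -cvg_shiftS.
have h2 : (c / (max_size theta)%:R * ratio v k) @[k --> \oo] -->
    c / (max_size theta)%:R * m v.
  by apply: cvgMl_tmp; exact: ratio_cvg.
apply: (ler_cvg_to h2 h1); near=> k.
rewrite /ratio; set N := iter_mean _ _ _ _ _.
set N' := iter_mean _ _ k.+1 _ _.
have N0 : 0 <= N by apply: iter_mean_occ_ge0.
have ms0 : 0 < (max_size theta)%:R :> R by rewrite ltr0n max_size_gt0.
have -> : c / (max_size theta)%:R * (N / L k) = c * N / ((max_size theta)%:R * L k).
  by rewrite invfM; ring.
(* In this direction the length may grow by the factor [max_size theta] in one step, hence the
   denominator in the statement. *)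
apply: (@le_trans _ _ (c * N / L k.+1)).
  rewrite ler_wpM2l ?mulr_ge0 // lef_pV2 ?posrE ?mulr_gt0 ?iter_len_gt0 //.
  by rewrite -natrM ler_nat iter_lenS_le.
rewrite ler_wpM2r ?invr_ge0 ?(ltW (iter_len_gt0 _)) // /N /N' iter_meanS //.
rewrite -iter_meanZ; apply: iter_mean_le => // x xk.
by apply: h; exact: legal_iter xk.
Unshelve. all: by end_near.
Qed.

Lemma occ_letter (a : A) u : occ [:: a] u = count_mem a u.
Proof. by elim: u => // b u IH; rewrite occ_cons IH /= prefix0s andbT eq_sym. Qed.

Lemma frequency_letter_gt0 a : 0 < m [:: a].
Proof.
have ra := PF_vector_gt0 hr a; have e0 : 0 < r a / 2 by rewrite divr_gt0.
have [C C0 hC] := letter_frequency hcomp hprim hlam hr a0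
  (fun b => (b == a)%:R) e0.
apply: lt_le_trans e0 _.
have h2 : (r a / 2 - C * (L k)^-1) @[k --> \oo] --> r a / 2 - C * 0.
  apply: cvgB; first exact: cvg_cst.
  by apply: cvgMl_tmp; exact: inv_iter_len_cvg0.
rewrite mulr0 subr0 in h2; apply: (ler_cvg_to h2 (@ratio_cvg _)); near=> k.
rewrite /ratio ler_pdivlMr ?iter_len_gt0 // mulrBl mulfVK ?gt_eqF ?iter_len_gt0 //.
rewrite -(iter_mean_cst hP k [:: a0] (_ - _)).
apply: iter_mean_le => // x xk; rewrite occ_letter.
have := hC x (legal_iter xk); rewrite (size_iter_image hcomp xk) -/(L k).
have -> : \sum_b r b * (b == a)%:R = r a.
  rewrite (bigD1 a) //= eqxx mulr1 big1 ?addr0 // => b /negPf ->.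
  by rewrite mulr0.
have -> : \sum_(b <- x) (b == a)%:R = (count_mem a x)%:R :> R.
  by rewrite -sum1_count [in RHS]big_mkcond natr_sum /=; apply: eq_bigr => b _;
    case: eqP.
rewrite ler_norml => /andP[+ _]; lra.
Unshelve. all: by end_near.
Qed.

End Frequencies.

Section AllWords.
Variable A : finType.

Fixpoint words (n : nat) : seq (seq A) :=
  if n is n'.+1 then [seq a :: w | a <- enum A, w <- words n'] else [:: [::]].

Lemma mem_words n w : (w \in words n) = (size w == n).
Proof.
elim: n w => [|n IH] w; first by rewrite inE size_eq0.
apply/allpairsP/idP => [[[a v] /= [_ + ->]]|]; first by rewrite IH.
by case: w => // a v; rewrite eqSS -IH => vn; exists (a, v); rewrite mem_enum.
Qed.

Lemma size_words n : size (words n) = (#|A| ^ n)%N.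
Proof. by elim: n => //= n IH; rewrite size_allpairs IH expnS cardE. Qed.

Lemma sum_wordsS (V : nmodType) n (F : seq A -> V) :
  \sum_(w <- words n.+1) F w = \sum_a \sum_(w <- words n) F (a :: w).
Proof. by rewrite /= big_allpairs_dep /= big_enum. Qed.

Lemma sum_wordsD (V : nmodType) j n (F : seq A -> V) :
  \sum_(w <- words (j + n)) F w =
  \sum_(x <- words j) \sum_(y <- words n) F (x ++ y).
Proof.
elim: j F => [|j IH] F; first by rewrite /= big_seq1.
by rewrite addSn !sum_wordsS; apply: eq_bigr => a _; rewrite IH.
Qed.

End AllWords.

Lemma prefix_cat_l (T : eqType) (w x y : seq T) : (size w <= size x)%N ->
  prefix w (x ++ y) = prefix w x.
Proof. by move=> h; rewrite !prefixE takel_cat. Qed.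

(** * Occurrences and likelihoods in one random image *)

Section OneStep.
Variables (R : realType) (A : finType) (theta : substitution A).
Hypothesis hcomp : compatible theta.
Variable P : A -> seq A -> R.
Hypothesis hP : permissible theta P.

Lemma occ_cat (w s y : seq A) : occ w (s ++ y) =
  (\sum_(q <- iota 0 (size s)) prefix w (drop q (s ++ y)) + occ w y)%N.
Proof.
elim: s => [|a s IH]; first by rewrite big_nil.
rewrite cat_cons occ_cons IH /= big_cons drop0 addnA; congr (_ + _ + _)%N.
by rewrite -[1%N]addn0 iotaDl big_map.
Qed.

(** Compatibility fixes the length of the first image, so the occurrences starting inside it have
    offsets in a range independent of the random choice. *)
Lemma image_mean_occ_cons w a u :
  image_mean theta P (a :: u) (fun x => (occ w x)%:R) =
  \sum_(q <- iota 0 (image_size theta a))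
     image_mean theta P (a :: u) (fun x => (prefix w (drop q x))%:R) +
  image_mean theta P u (fun x => (occ w x)%:R).
Proof.
rewrite -(image_mean_sum theta P) !(image_mean_cons hP) /=.
have [_ _ P1] := hP a.
have avg x : x = \sum_(s <- theta a) P a s * x by rewrite -mulr_suml P1 mul1r.
rewrite [X in _ + X]avg -big_split /=.
rewrite big_seq [RHS]big_seq; apply: eq_bigr => s sa.
rewrite -mulrDr; congr (_ * _).
rewrite /image_mean -big_split; apply: eq_bigr => y _ /=.
by rewrite -mulrDr occ_cat natrD natr_sum (size_subst hcomp sa).
Qed.

(** Each occurrence of [v] in [u] becomes [x], at the start of its image, with probability
    [word_prob theta P v x]; the induction keeps only offset 0 of the first block. *)
Lemma image_mean_occ_ge v u x :
  word_prob theta P v x * (occ v u)%:R <=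
  image_mean theta P u (fun y => (occ x y)%:R).
Proof.
elim: u => [|a u IH].
  rewrite /occ /= mulr0; apply: (image_mean_ge0 hP) => *; exact: ler0n.
rewrite image_mean_occ_cons occ_cons natrD mulrDr lerD //.
have Pge0 q : 0 <= image_mean theta P (a :: u)
    (fun y : seq A => (prefix x (drop q y))%:R).
  by apply: (image_mean_ge0 hP) => y _; rewrite ler0n.
have [/prefixP [u' E]|_] := boolP (prefix v (a :: u)); last first.
  by rewrite mulr0 sumr_ge0 // => q _.
rewrite -[image_size theta a]prednK ?image_size_gt0 //= big_cons.
rewrite mulr1 ler_wpDr ?sumr_ge0 // E (image_mean_cat hP).
rewrite (word_prob_mean hP); apply: (image_mean_le hP) => y _.
case: eqP => [->|_]; last first.
  by apply: (image_mean_ge0 hP) => z _; rewrite ler0n.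
under eq_fun do rewrite drop0 prefix_prefix.
by rewrite (image_mean_cst hP).
Qed.

(** An occurrence of [w] starting at offset [q] in the image of a letter is covered by the image of
    the [n] letters from there on. The additive constant accounts for the end of [u], where fewer
    than [n] letters remain. *)
Lemma image_mean_occ_le n w u : (0 < n)%N ->
  (forall v, legal theta v -> size v = n ->
     (size w + max_size theta <= image_len theta v)%N) ->
  legal theta u ->
  image_mean theta P u (fun x => (occ w x)%:R) <=
  \sum_(v <- words A n) \sum_(q <- iota 0 (max_size theta))
    image_mean theta P v (fun x => (prefix w (drop q x))%:R) * (occ v u)%:R
  + (max_size theta * n)%:R.
Proof.
move=> n0 hn.
pose c v q := image_mean theta P v (fun x => (prefix w (drop q x))%:R).
have c0 v q : 0 <= c v q by apply: (image_mean_ge0 hP) => x _; rewrite ler0n.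
have sum0 u' : 0 <= \sum_(v <- words A n) \sum_(q <- iota 0 (max_size theta))
    c v q * (occ v u')%:R.
  by rewrite sumr_ge0 // => v _; rewrite sumr_ge0 // => q _; rewrite mulr_ge0.
rewrite -/c; have small u' : (size u' < n)%N ->
    image_mean theta P u' (fun x => (occ w x)%:R) <=
    \sum_(v <- words A n) \sum_(q <- iota 0 (max_size theta))
    c v q * (occ v u')%:R + (max_size theta * n)%:R.
  move=> un; rewrite ler_wpDl //.
  rewrite -(image_mean_cst hP (max_size theta * n)%:R u').
  apply: (image_mean_le hP) => x xu; rewrite ler_nat.
  rewrite (leq_trans (occ_size _ _)) // (size_word_image hcomp xu).
  by rewrite (leq_trans (image_len_le theta u')) // leq_mul2l ltnW ?orbT.
elim: u => [|a u IH] lu; first exact: small.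
have [/small //|nu] := ltnP (size (a :: u)) n.
have lu' : legal theta u.
  by apply: legal_infix lu; rewrite -cat1s; exact: suffixW (suffix_suffix _ _).
rewrite image_mean_occ_cons.
set v := take n (a :: u).
have lv : legal theta v by apply: legal_take.
have sv : size v = n by rewrite size_takel.
have vn : v \in words A n by rewrite mem_words sv.
have step : \sum_(q <- iota 0 (image_size theta a))
    image_mean theta P (a :: u) (fun x => (prefix w (drop q x))%:R) <=
    \sum_(v' <- words A n) \sum_(q <- iota 0 (max_size theta))
      c v' q * (prefix v' (a :: u))%:R.
  apply: (@le_trans _ _ (\sum_(q <- iota 0 (max_size theta)) c v q)).
    rewrite -(subnKC (leq_max_size theta a)) iotaD big_cat /=.
    rewrite ler_wpDr ?sumr_ge0 // !big_seq ler_sum // => q.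
    rewrite mem_iota add0n => /= qa.
    rewrite -{1}(cat_take_drop n (a :: u)) (image_mean_cat hP).
    apply: (image_mean_le hP) => x xv.
    rewrite -[leRHS](image_mean_cst hP _ (drop n (a :: u))).
    apply: (image_mean_le hP) => y _.
    have sx : (size w + max_size theta <= size x)%N.
      by rewrite (size_word_image hcomp xv) hn.
    have qm : (q < max_size theta)%N by apply: leq_trans qa (leq_max_size _ _).
    have qx : (size w + q <= size x)%N by lia.
    have qx' : (q < size x)%N by lia.
    by rewrite drop_cat qx' prefix_cat_l // size_drop leq_subRL ?(ltnW qx') //
      addnC.
  rewrite (big_rem v) // ler_wpDr //.
    by rewrite sumr_ge0 // => v' _; rewrite sumr_ge0 // => q _; rewrite mulr_ge0.
  have -> : prefix v (a :: u) = true by apply: prefix_take.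
  by under [leRHS]eq_bigr do rewrite mulr1.
apply: le_trans (lerD step (IH lu')) _.
rewrite addrA lerD2r le_eqVlt; apply/orP; left; apply/eqP.
rewrite -big_split; apply: eq_bigr => v' _; rewrite -big_split.
by apply: eq_bigr => q _; rewrite occ_cons natrD mulrDr.
Qed.

(** All images of [a] have the same length, so only one can be a prefix and the sum defining
    [word_prob] has a single nonzero term. *)
Lemma word_prob_cat_cons a v s x : s \in theta a ->
  word_prob theta P (a :: v) (s ++ x) = P a s * word_prob theta P v x.
Proof.
move=> sa /=; rewrite big_mkcond (big_fsetD1 s) //= prefix_prefix.
rewrite drop_size_cat // big_seq big1 ?addr0 // => s'.
rewrite in_fsetD1 => /andP[ns sa']; case: ifP => //.
rewrite prefixE (size_subst hcomp sa') -(size_subst hcomp sa) take_size_cat //.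
by rewrite eq_sym (negPf ns).
Qed.

(** An image of [v] splits uniquely by compatibility, so its probability under [P] is a product;
    independence under [Q] then factorises the moment. *)
Lemma image_mean_word_prob_powR (Q : A -> seq A -> R) (hQ : permissible theta Q)
    (t : R) v :
  image_mean theta Q v (fun x => word_prob theta P v x `^ t) =
  \prod_(a <- v) \sum_(s <- theta a) Q a s * P a s `^ t.
Proof.
elim: v => [|a v IH]; first by rewrite (image_mean_nil theta Q) /= big_nil powR1.
rewrite (image_mean_cons hQ) big_cons -IH mulr_suml.
rewrite big_seq [RHS]big_seq; apply: eq_bigr => s sa; rewrite -mulrA.
congr (_ * _); rewrite -image_meanZ; apply: eq_image_mean => x xv.
by rewrite word_prob_cat_cons // powRM ?(word_prob_ge0 hP) ?(permissible_ge0 hP).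
Qed.

End OneStep.

(** * Local recognisability *)

(** An ultrafilter decides between finitely many alternatives. One ultrafilter serves all
    coordinates at once and replaces a diagonal extraction. *)
Lemma ultra_limit (T : eqType) (U : set_system nat) (f : nat -> T) (s : seq T) :
  UltraFilter U -> (\forall n \near U, f n \in s) ->
  exists t, \forall n \near U, f n = t.
Proof.
move=> ultraU; elim: s => [|a s IH] h.
  have : U set0 by apply: filterS h.
  by move/filter_not_empty.
have [Ua|Una] := in_ultra_setVsetC [set n | f n = a] ultraU.
  by exists a.
apply: IH; move: h Una; apply: filterS2 => n.
by rewrite inE => /orP[/eqP|].
Qed.

Section LocalRecognisability.
Variables (A : finType) (theta : substitution A).

(* [c] and [k] play the same role as in [biinf_image] and [recognisable], but
   all conditions are restricted to the window [-n, n]. *)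
Definition window_tiling (n : nat) (x y : int -> A) (v : int -> seq A)
    (c : int -> int) (k : nat) : Prop :=
  [/\ forall (i : int) (m : nat), - n%:Z <= i -> i + m%:Z <= n%:Z ->
        legal theta (factor x i m),
      forall (i : int) (m : nat), - n%:Z <= i -> i + m%:Z <= n%:Z ->
        legal theta (factor y i m),
      c 0 = 0, (k < image_size theta (y 0))%N &
      forall j : int, (`|j| <= n)%N ->
        [/\ v j \in theta (y j), c (j + 1) = c j + (size (v j))%:Z &
            factor x (c j - k%:Z) (size (v j)) = v j]].

Section Limit.
Variable U : set_system nat.
Hypotheses (ultraU : UltraFilter U) (leU : \oo `<=` U).

Lemma near_factor (x : nat -> int -> A) (z : int -> A) i m :
  (forall i, \forall n \near U, x n i = z i) ->
  \forall n \near U, factor (x n) i m = factor z i m.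
Proof.
move=> h; elim: m => [|m IH]; first exact: nearW.
move: (h (i + m%:Z)) IH; apply: filterS2 => n h1 h2.
by rewrite /factor !mkseqS -!/(factor _ _ _) h1 h2.
Qed.

(** Each single condition on the limit concerns finitely many coordinates, so it can be read off at
    one index [n] where these agree with the limit and the window contains them. *)
Lemma window_tiling_limit (x y : nat -> int -> A) (v : nat -> int -> seq A)
    (c : nat -> int -> int) (k : nat -> nat) (z : int -> A) :
  (forall n, window_tiling n (x n) (y n) (v n) (c n) (k n)) ->
  (forall i, \forall n \near U, x n i = z i) ->
  subshift theta z /\
  exists (w : int -> A) (l : nat),
    [/\ subshift theta w, (l < image_size theta (w 0))%N,
        biinf_image theta w (shift (- l%:Z) z) &
        \forall n \near U, y n 0 = w 0 /\ k n = l].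
Proof.
move=> ht hx.
have big (N : nat) : \forall n \near U, (N <= n)%N by apply: leU;
  exact: nbhs_infty_ge.
split.
  move=> i m.
  near U => n; have [hl _ _ _ _] := ht n.
  have <- : factor (x n) i m = factor z i m by near: n; exact: near_factor.
  have : (`|i| + m <= n)%N by near: n; exact: big.
  by move=> hn; apply: hl; lia.
have /choice [w hw] : forall i, exists t, \forall n \near U, y n i = t.
  move=> i; apply: (@ultra_limit _ _ _ (enum A)) => //.
  by apply: nearW => n; rewrite mem_enum.
have /choice [v' hv] : forall j, exists t, \forall n \near U, v n j = t.
  move=> j; apply: (@ultra_limit _ _ _ (theta (w j))) => //.
  near=> n; have [_ _ _ _ ] := ht n.
  move=> /(_ j) []; first by near: n; exact: big.
  have -> : y n j = w j by near: n.
  by [].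
have [l hl] : exists t, \forall n \near U, k n = t.
  apply: (@ultra_limit _ _ _ (iota 0 (image_size theta (w 0)))) => //.
  near=> n; have [_ _ _ + _] := ht n.
  have -> : y n 0 = w 0 by near: n.
  by rewrite mem_iota.
(* No finite range for the cut positions is given in advance; they stabilise by induction from
   [c 0 = 0] in both directions, as tile lengths do. *)
have /choice [c' hc] : forall j, exists t, \forall n \near U, c n j = t.
  elim/int_ind => [|j [t IH]|j [t IH]].
  - by exists 0; apply: nearW => n; have [] := ht n.
  - exists (t + (size (v' j))%:Z); near=> n.
    have [_ _ _ _ ] := ht n.
    move=> /(_ j%:Z) []; first by near: n; exact: big.
    have -> : c n j%:Z = t by near: n.
    have -> : v n j%:Z = v' j%:Z by near: n; exact: hv.
    have -> : j%:Z + 1 = j.+1%:Z by lia.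
    by move=> _ -> _.
  - exists (t - (size (v' (- j.+1%:Z)))%:Z); near=> n.
    have [_ _ _ _ ] := ht n.
    move=> /(_ (- j.+1%:Z)) []; first by near: n; exact: big.
    have -> : - j.+1%:Z + 1 = - j%:Z by lia.
    have -> : c n (- j%:Z) = t by near: n.
    have -> : v n (- j.+1%:Z) = v' (- j.+1%:Z) by near: n; exact: hv.
    by move=> _ -> _; rewrite addrK.
exists w, l; split.
- move=> i m.
  near U => n; have [_ hl' _ _ _] := ht n.
  have <- : factor (y n) i m = factor w i m by near: n; exact: near_factor.
  have : (`|i| + m <= n)%N by near: n; exact: big.
  by move=> hn; apply: hl'; lia.
- near U => n; have [_ _ _ + _] := ht n.
  have -> : y n 0 = w 0 by near: n.
  by have -> : k n = l by near: n.
- exists v', c'; split.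
  + move=> j; near U => n; have [_ _ _ _ ] := ht n.
    move=> /(_ j) []; first by near: n; exact: big.
    have -> : y n j = w j by near: n.
    by have -> : v n j = v' j by near: n; exact: hv.
  + near U => n; have [_ _ + _ _ ] := ht n.
    by have -> : c n 0 = c' 0 by near: n; exact: hc.
  + move=> j; near U => n; have [_ _ _ _ ] := ht n.
    move=> /(_ j) []; first by near: n; exact: big.
    have -> : c n j = c' j by near: n; exact: hc.
    have -> : c n (j + 1) = c' (j + 1) by near: n; exact: hc.
    by have -> : v n j = v' j by near: n; exact: hv.
  + move=> j; near U => n; have [_ _ _ _ ] := ht n.
    move=> /(_ j) []; first by near: n; exact: big.
    have -> : c n j = c' j by near: n; exact: hc.
    have -> : v n j = v' j by near: n; exact: hv.
    have -> : k n = l by near: n.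
    have -> : factor (x n) (c' j - l%:Z) (size (v' j)) =
        factor z (c' j - l%:Z) (size (v' j)) by near: n; exact: near_factor.
    move=> _ _ <-; rewrite /factor /shift size_mkseq.
    by apply: eq_mkseq => i; rewrite addrAC.
- by near=> n; split; near: n.
Unshelve. all: by end_near.
Qed.

End Limit.

(** If no radius worked, there would be, for every [n], two tilings of one window that disagree at
    the origin. Their ultralimits are preimages of the same point and still disagree, against
    uniqueness. *)
Lemma local_recognisability : recognisable theta ->
  exists n, forall x y1 v1 c1 k1 y2 v2 c2 k2,
    window_tiling n x y1 v1 c1 k1 -> window_tiling n x y2 v2 c2 k2 ->
    y1 0 = y2 0 /\ k1 = k2.
Proof.
move=> hrec; apply: contrapT => nex.
pose tdata := ((int -> A) * (int -> seq A) * (int -> int) * nat)%type.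
pose tiles n x (d : tdata) := window_tiling n x d.1.1.1 d.1.1.2 d.1.2 d.2.
have /choice [F hF] : forall n, exists d : (int -> A) * tdata * tdata,
    [/\ tiles n d.1.1 d.1.2, tiles n d.1.1 d.2 &
      ~ (d.1.2.1.1.1 0 = d.2.1.1.1 0 /\ d.1.2.2 = d.2.2)].
  move=> n; apply: contrapT => nd; apply: nex; exists n.
  move=> x y1 v1 c1 k1 y2 v2 c2 k2 t1 t2; apply: contrapT => ne.
  by apply: nd; exists (x, (y1, v1, c1, k1), (y2, v2, c2, k2)).
have [U [ultraU leU]] := @ultraFilterLemma nat \oo _.
have /choice [z hz] : forall i, exists t, \forall n \near U, (F n).1.1 i = t.
  move=> i; apply: (@ultra_limit _ _ _ (enum A)) => //.
  by apply: nearW => n; rewrite mem_enum.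
have t1 n : tiles n (F n).1.1 (F n).1.2 by have [] := hF n.
have t2 n : tiles n (F n).1.1 (F n).2 by have [] := hF n.
have [Xz [w1 [l1 [Xw1 k1 b1 n1]]]] := window_tiling_limit ultraU leU t1 hz.
have [_ [w2 [l2 [Xw2 k2 b2 n2]]]] := window_tiling_limit ultraU leU t2 hz.
have [[w l] [_ uniq]] := hrec z Xz.
have [e1 e2] : (w1, l1) = (w2, l2).
  by rewrite -(uniq (w1, l1)) // -(uniq (w2, l2)).
near U => n; have [_ _] := hF n; apply.
have [-> ->] : (F n).1.2.1.1.1 0 = w1 0 /\ (F n).1.2.2 = l1 by near: n.
have [-> ->] : (F n).2.1.1.1 0 = w2 0 /\ (F n).2.2 = l2 by near: n.
by rewrite e1 e2.
Unshelve. all: by end_near.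
Qed.

End LocalRecognisability.

Lemma factor_nth (A : finType) (a0 : A) (s : seq A) (o i : int) (m : nat) :
  0 <= i + o -> i + o + m%:Z <= (size s)%:Z ->
  factor (fun j => nth a0 s (absz (j + o))) i m = take m (drop (absz (i + o)) s).
Proof.
move=> h1 h2; apply: (@eq_from_nth _ a0).
  by rewrite size_mkseq size_takel // size_drop; lia.
move=> j; rewrite size_mkseq => jm.
rewrite nth_mkseq // nth_take // nth_drop; congr nth; lia.
Qed.

Lemma take_drop_window (T : Type) (s : seq T) (a b c m : nat) : (a + m <= b)%N ->
  take m (drop a (take b (drop c s))) = take m (drop (a + c) s).
Proof.
move=> h; rewrite -(@subnK a b); last by apply: leq_trans h; rewrite leq_addr.
by rewrite -take_drop drop_drop take_takel // leq_subRL // (leq_trans _ h)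
  ?leq_addr.
Qed.

(** * Recognisability for finite words *)

Section Core.
Variables (A : finType) (a0 : A) (theta : substitution A).
Hypothesis hcomp : compatible theta.

Definition block_start (u : seq A) (i : nat) : nat := image_len theta (take i u).

Definition tile (u x : seq A) (i : nat) : seq A :=
  take (image_size theta (nth a0 u i)) (drop (block_start u i) x).

Lemma block_startD u i j : block_start u (i + j) = (block_start u i + image_len
  theta (take j (drop i u)))%N.
Proof. by rewrite /block_start takeD image_len_cat. Qed.

Lemma block_startS u i : (i < size u)%N ->
  block_start u i.+1 = (block_start u i + image_size theta (nth a0 u i))%N.
Proof.
move=> iu; rewrite -addn1 block_startD (drop_nth a0) //= take0.
by rewrite image_len_cons /image_len big_nil addn0.
Qed.

Lemma block_start_le u i j : (i <= j)%N ->
  (block_start u i <= block_start u j <= block_start u i + max_size theta * (j -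
    i))%N.
Proof.
move=> ij; rewrite -{1 2}(subnKC ij) block_startD leq_addr leq_add2l /=.
apply: leq_trans (image_len_le theta _) _.
by rewrite leq_mul2l size_take_min geq_minl orbT.
Qed.

Lemma block_start_size u : block_start u (size u) = image_len theta u.
Proof. by rewrite /block_start take_size. Qed.

Lemma block_start0 u : block_start u 0 = 0%N.
Proof. by rewrite /block_start take0 /image_len big_nil. Qed.

Lemma block_start_inj u i j : (i <= size u)%N -> (j <= size u)%N ->
  block_start u i = block_start u j ->
  i = j.
Proof.
wlog ij : i j / (i <= j)%N.
  by move=> W iu ju e; case: (leqP i j) => [|/ltnW] h; [|symmetry]; apply: W.
move=> iu ju e; apply/eqP; rewrite eqn_leq ij /= leqNgt; apply/negP => ltij.
have iu' : (i < size u)%N by apply: leq_trans ju.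
have /andP[h _] := block_start_le u ltij.
by move: h; rewrite block_startS // -e -{2}[block_start u i]addn0 leq_add2l leqNgt
  image_size_gt0.
Qed.

Lemma locate u p : (p < image_len theta u)%N ->
  exists2 i, (i < size u)%N & (block_start u i <= p < block_start u i.+1)%N.
Proof.
move=> pu; have ex : exists i, (p < block_start u i)%N by exists (size u);
  rewrite block_start_size.
case: (ex_minnP ex) => -[|i]; first by rewrite block_start0.
move=> pi hmin; exists i; last first.
  by rewrite pi andbT leqNgt; apply/negP => /hmin; rewrite ltnn.
by apply: (hmin (size u)); rewrite block_start_size.
Qed.

Lemma word_image_splitP (u x : seq A) i : x \in word_image theta u ->
  take (block_start u i) x \in word_image theta (take i u) /\
  drop (block_start u i) x \in word_image theta (drop i u).
Proof.
rewrite -{1}(cat_take_drop i u) => /word_image_catP [y [z [yu zu ->]]].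
by rewrite /block_start -(size_word_image hcomp yu) take_size_cat // drop_size_cat.
Qed.

Lemma tile_in (u x : seq A) i : x \in word_image theta u -> (i < size u)%N ->
  tile u x i \in theta (nth a0 u i).
Proof.
move=> xu iu; have [_] := word_image_splitP i xu.
rewrite (drop_nth a0 iu) => /word_image_consP [s [z [sa zu E]]].
by rewrite /tile E -(size_subst hcomp sa) take_size_cat.
Qed.

Definition window_word (kap p : nat) (x : seq A) : seq A :=
  take (kap + kap) (drop (p - kap) x).

(** The constant [kap] leaves room for [n] tiles on either side and the tile containing [p]. The
    shifts put position [p] of [x] and letter [i] of [u] at the origin; the conditions never look at
    the junk values of [nth] and [absz] outside the words. *)
Lemma window_tiling_word n (u x : seq A) p i : let kap :=
  (n.+1 * max_size theta)%N in
  legal theta u -> x \in word_image theta u -> (i < size u)%N ->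
  (block_start u i <= p < block_start u i.+1)%N -> (kap <= p)%N ->
    (p + kap <= size x)%N ->
  window_tiling theta n (fun j => nth a0 (window_word kap p x) (absz (j + kap%:Z)))
    (fun j => nth a0 u (absz (j + i%:Z))) (fun j => tile u x (absz (j + i%:Z)))
    (fun j => (block_start u (absz (j + i%:Z)))%:Z - (block_start u i)%:Z) (p -
      block_start u i)%N.
Proof.
move=> kap lu xu iu /andP[ip pi] kp px.
have lx := legal_image lu xu.
have szx := size_word_image hcomp xu.
have ms0 : (0 < max_size theta)%N := max_size_gt0 a0 theta.
have nkap : (n < kap)%N by apply: leq_pmulr.
have kapE : kap = (n * max_size theta + max_size theta)%N.
  by rewrite /kap mulSn addnC.
have szB : size (window_word kap p x) = (kap + kap)%N.
  by rewrite /window_word size_takel // size_drop; lia.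
have ni : (n < i)%N.
  rewrite -ltnS -(ltn_pmul2r ms0) -/kap.
  apply: leq_ltn_trans kp (leq_trans pi _).
  have /andP[_] := @block_start_le u 0 i.+1 (leq0n _).
  by rewrite block_start0 add0n subn0 mulnC.
have iu_n : (i + n < size u)%N.
  have /andP[_] := block_start_le u (ltnW iu); rewrite block_start_size -szx => h.
  have : (n.+1 * max_size theta <= (size u - i) * max_size theta)%N.
    rewrite -/kap [leqRHS]mulnC; move: (max_size theta * _)%N h => D h.
    by clearbody kap; lia.
  by rewrite leq_pmul2r //; lia.
split.
- move=> j m h1 h2; rewrite factor_nth; [|lia|rewrite szB; lia].
  by apply/legal_take/legal_drop/legal_take/legal_drop.
- move=> j m h1 h2; rewrite factor_nth; [|lia|lia].
  by apply/legal_take/legal_drop.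
- by rewrite add0r subrr.
- rewrite add0r /=; move: pi; rewrite block_startS //; lia.
move=> j jn; pose i' := absz (j + i%:Z).
have iE : (i'%:Z = j + i%:Z) by rewrite /i'; lia.
have i'u : (i' < size u)%N by lia.
rewrite -/i'; split; first exact: tile_in.
  have -> : absz (j + 1 + i%:Z) = i'.+1 by lia.
  have -> : size (tile u x i') = image_size theta (nth a0 u i').
    by apply: size_subst => //; apply: tile_in.
  by rewrite block_startS //; lia.
have sz : size (tile u x i') = image_size theta (nth a0 u i').
  by apply: size_subst => //; apply: tile_in.
have lo : (block_start u i <= block_start u i' + n * max_size theta)%N.
  case: (leqP i i') => h.
    by have /andP[h' _] := block_start_le u h; rewrite (leq_trans h') // leq_addr.
  have /andP[_ h'] := block_start_le u (ltnW h); apply: (leq_trans h').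
  by rewrite leq_add2l mulnC leq_mul2r; apply/orP; right; lia.
have hi : (block_start u i'.+1 <= block_start u i + kap)%N.
  case: (leqP i i'.+1) => h.
    have /andP[_ h'] := block_start_le u h; apply: (leq_trans h').
    by rewrite leq_add2l mulnC leq_mul2r; apply/orP; right; lia.
  by have /andP[h' _] := block_start_le u (ltnW h);
    rewrite (leq_trans h') // leq_addr.
have szi := leq_max_size theta (nth a0 u i).
have piS : (p < block_start u i + image_size theta (nth a0 u i))%N
  by rewrite -block_startS.
have hiS := block_startS i'u.
rewrite sz factor_nth ?szB; [|lia|lia].
rewrite /window_word take_drop_window; last by lia.
by rewrite /tile -/i'; congr (take _ (drop _ x)); lia.
Qed.

Hypothesis hrec : recognisable theta.

Lemma word_recognisability : exists2 kap, (0 < kap)%N &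
  forall (u1 u2 x1 x2 : seq A) p1 p2 i1 i2,
    legal theta u1 -> legal theta u2 ->
    x1 \in word_image theta u1 -> x2 \in word_image theta u2 ->
    (i1 < size u1)%N -> (i2 < size u2)%N ->
    (block_start u1 i1 <= p1 < block_start u1 i1.+1)%N ->
      (block_start u2 i2 <= p2 < block_start u2 i2.+1)%N ->
    (kap <= p1)%N -> (p1 + kap <= size x1)%N ->
    (kap <= p2)%N -> (p2 + kap <= size x2)%N ->
    window_word kap p1 x1 = window_word kap p2 x2 ->
    nth a0 u1 i1 = nth a0 u2 i2 /\ (p1 - block_start u1 i1 = p2 - block_start u2
      i2)%N.
Proof.
have [n hn] := local_recognisability hrec.
exists (n.+1 * max_size theta)%N; first by rewrite muln_gt0 (max_size_gt0 a0).
move=> u1 u2 x1 x2 p1 p2 i1 i2 l1 l2 x1u x2u i1u i2u c1 c2 k1 k1' k2 k2' E.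
have t1 := window_tiling_word l1 x1u i1u c1 k1 k1'.
have t2 := window_tiling_word l2 x2u i2u c2 k2 k2'.
rewrite -E in t2.
by have [] := hn _ _ _ _ _ _ _ _ _ t1 t2; rewrite add0r.
Qed.

(** A word of two or more letters does not fit into the starting letter, so at least one step was
    made, and the last one provides [u]. *)
Lemma legal_occurrence (w : seq A) : legal theta w -> (1 < size w)%N ->
  exists (u x : seq A) p, [/\ legal theta u, x \in word_image theta u,
    (p + size w <= size x)%N & take (size w) (drop p x) = w].
Proof.
move=> [k [a [W + /infixP [y [z E]]]]] w1; case: k => [|k].
  rewrite in_fset1 => /eqP Wa; have := congr1 size E; rewrite Wa !size_cat /=.
  lia.
move=> /iter_imageSP [u uk Wu]; exists u, W, (size y).
split; [exact: legal_iter uk| exact: Wu| |].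
  by rewrite E !size_cat addnA leq_addr.
by rewrite E drop_size_cat // take_size_cat.
Qed.

Lemma window_word_drop kap (w x : seq A) P q : (kap <= q)%N ->
  (q + kap <= size w)%N -> take (size w) (drop P x) = w ->
  window_word kap (P + q) x = window_word kap q w.
Proof.
move=> kq qw E; rewrite /window_word -[in RHS]E take_drop_window; last by lia.
by congr (take _ (drop _ x)); lia.
Qed.

(* By recognisability the inner preimage [v] does not depend on the occurrence
   of [w]; the margin [kap] allows for the recognisability radius and one tile at
   either end of [w]. *)
Lemma inner_preimage : exists kap, forall (w : seq A) n,
  legal theta w -> (1 < size w)%N -> (0 < n)%N ->
  (forall v, legal theta v -> (size v <= n)%N ->
     (image_len theta v + kap <= size w)%N) ->
  exists p v, [/\ size v = n, legal theta v, (p + image_len theta v <= size w)%N &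
    forall (u x : seq A) P, legal theta u -> x \in word_image theta u ->
      take (size w) (drop P x) = w -> (P + size w <= size x)%N ->
      exists2 i, block_start u i = (P + p)%N & prefix v (drop i u)].
Proof.
have [kap kap0 hk] := word_recognisability.
have ms0 : (0 < max_size theta)%N := max_size_gt0 a0 theta.
pose kap' := (kap + max_size theta)%N.
exists (kap' + kap')%N => w n lw w1 n0 hn.
have [u0 [x0 [P0 [lu0 xu0 P0w E0]]]] := legal_occurrence lw w1.
have szx0 := size_word_image hcomp xu0.
have w_big : (kap' + kap' <= size w)%N.
  by have := hn [::] (legal_nil theta a0) (leq0n _); rewrite /image_len big_nil.
(* The block [v] begins with the tile after the one at [P0 + kap], which puts its start [p] between
   [kap] and [kap + max_size theta]. *)
have [|j0 j0u /andP[j0a j0b]] := @locate u0 (P0 + kap).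
  by rewrite -szx0; move: w_big; rewrite /kap'; lia.
have cutj0 := block_startS j0u; have szj0 := leq_max_size theta (nth a0 u0 j0).
pose p := (block_start u0 j0.+1 - P0)%N; pose v := take n (drop j0.+1 u0).
have pE : block_start u0 j0.+1 = (P0 + p)%N by rewrite /p; lia.
have kp : (kap <= p)%N by rewrite /p; lia.
have pk : (p <= kap')%N by rewrite /p /kap'; lia.
have lv : legal theta v by apply/legal_take/legal_drop.
(* Were there fewer than [n] letters left in [u0], their images would be too short, by [hn], to fill
   the rest of [w]. *)
have sv : size v = n.
  rewrite size_takel // leqNgt; apply/negP => small.
  have := hn _ (legal_drop j0.+1 lu0) (ltnW small).
  have := image_len_cat theta (take j0.+1 u0) (drop j0.+1 u0).
  rewrite cat_take_drop -szx0 -/(block_start _ _) pE; move: P0w pk ms0 w_big.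
  rewrite /kap'; move: (image_len theta _) => D; lia.
have pv : (p + image_len theta v + kap' <= size w)%N.
  by have := hn v lv; rewrite sv leqnn => /(_ isT); lia.
exists p, v; split => //; first by lia.
move=> u x P lu xu E Pw.
have szx := size_word_image hcomp xu.
(* Comparison with the reference occurrence: the windows around the two positions lie in the same
   [w], so a tile of [u] containing the expected start of tile [j] of [v] has the same letter and
   starts there. *)
have ref j : (j < n)%N -> forall i, (i < size u)%N ->
    (block_start u i <= P + p + image_len theta (take j v) < block_start u i.+1)%N
      ->
    nth a0 u i = nth a0 v j /\ block_start u i = (P + p + image_len theta (take j
      v))%N.
  move=> jn i iu hi; pose q := (p + image_len theta (take j v))%N.
  have jD : (j < size (drop j0.+1 u0))%N.
    by move: sv; rewrite /v size_take; case: ltnP => // h; lia.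
  have tjv : take j v = take j (drop j0.+1 u0) by rewrite /v take_takel // ltnW.
  have cj : block_start u0 (j0.+1 + j) = (P0 + q)%N
    by rewrite block_startD pE -tjv /q addnA.
  have ju0 : (j0.+1 + j < size u0)%N by move: jD; rewrite size_drop; lia.
  have qv : (image_len theta (take j v) <= image_len theta v)%N.
    by rewrite -{2}(cat_take_drop j v) image_len_cat leq_addr.
  have kq : (kap <= q)%N by rewrite /q; lia.
  have qk : (q + kap <= size w)%N by move: pv; rewrite /q /kap'; lia.
  have [|||||||e1 e2] := hk u u0 x x0 (P + q)%N (P0 + q)%N i (j0.+1 + j)%N lu lu0
    xu xu0 iu ju0.
  - by rewrite /q addnA.
  - by rewrite -cj leqnn block_startS // -[X in (X < _)%N]addn0 ltn_add2l
    image_size_gt0.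
  - by lia.
  - by lia.
  - by lia.
  - by lia.
  - by rewrite (window_word_drop kq qk E) (window_word_drop kq qk E0).
  split.
    by rewrite e1 /v nth_take // nth_drop.
  by move: e2; rewrite cj subnn -addnA -/q; move: hi; rewrite -addnA -/q; lia.
have [i iu hi] : exists2 i, (i < size u)%N & (block_start u i <= P + p <
  block_start u i.+1)%N.
  by apply: locate; rewrite -szx; lia.
have [ei ci] := ref 0%N n0 i iu ltac:(by rewrite take0 /image_len big_nil addn0).
rewrite take0 /image_len big_nil addn0 in ci.
exists i => //.
have main j : (j <= n)%N -> (j <= size (drop i u))%N /\ take j (drop i u) = take j
  v.
  elim: j => [|j IH] jn; first by rewrite !take0.
  have [ju tE] := IH (ltnW jn).
  have cij : block_start u (i + j) = (P + p + image_len theta (take j v))%N.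
    by rewrite block_startD ci tE.
  have qv : (image_len theta (take j v) <= image_len theta v)%N.
    by rewrite -{2}(cat_take_drop j v) image_len_cat leq_addr.
  have [|i' i'u hi'] := @locate u (P + p + image_len theta (take j v)).
    by rewrite -szx; lia.
  have [e1 e2] := ref j jn i' i'u hi'.
  have iju : (i + j <= size u)%N by move: ju; rewrite size_drop; lia.
  have i'E : i' = (i + j)%N by apply: (block_start_inj (ltnW i'u) iju);
    rewrite e2 cij.
  have jlt : (j < size (drop i u))%N by rewrite size_drop; lia.
  split=> //; rewrite (take_nth a0 jlt) (take_nth a0 (_ : j < size v)%N) ?sv // tE;
    congr rcons.
  by rewrite nth_drop -i'E.
have [_ e] := main n (leqnn n).
rewrite -sv take_size in e; rewrite -e sv; exact: prefix_take.
Qed.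

(** An occurrence of [w] at [P] is sent to the index whose block starts at [P + p]; this is
    injective because the block start recovers [P]. *)
Lemma occ_le_inner (u x w v : seq A) p : x \in word_image theta u ->
  (0 < size v)%N -> (p + image_len theta v <= size w)%N ->
  (forall P, take (size w) (drop P x) = w -> (P + size w <= size x)%N ->
     exists2 i, block_start u i = (P + p)%N & prefix v (drop i u)) ->
  (occ w x <= \sum_(i <- iota 0 (size u)) prefix v (drop i u) *
     (take (image_len theta v) (drop (block_start u i) x) ==
      take (image_len theta v) (drop p w)))%N.
Proof.
move=> xu v0 pv h.
pose g i := prefix v (drop i u) &&
  (take (image_len theta v) (drop (block_start u i) x) ==
      take (image_len theta v) (drop p w)).
have -> : (\sum_(i <- iota 0 (size u)) prefix v (drop i u) *
     (take (image_len theta v) (drop (block_start u i) x) ==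
      take (image_len theta v) (drop p w)))%N = count g (iota 0 (size u)).
  by rewrite -sum1_count [RHS]big_mkcond /=; apply: eq_bigr => i _;
    rewrite mulnb /g; case: ifP.
rewrite /occ -!size_filter -(size_map (addn^~ p)) -[leqRHS](size_map (block_start
  u)).
apply: uniq_leq_size.
  by rewrite map_inj_uniq ?filter_uniq ?iota_uniq //; exact: addIn.
move=> q /mapP [P]; rewrite mem_filter mem_iota add0n /= => /andP[wP Px] ->.
have szP : (P + size w <= size x)%N.
  by move: (size_prefix wP); rewrite size_drop leq_subRL // ltnW.
have E : take (size w) (drop P x) = w by move: wP; rewrite prefixE => /eqP.
have [i ci vi] := h P E szP.
apply/mapP; exists i; last by rewrite ci.
rewrite mem_filter mem_iota add0n /= /g vi /= ci.
have -> : (i < size u)%N.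
  by move: (leq_trans v0 (size_prefix vi)); rewrite size_drop subn_gt0.
by rewrite andbT -[w in X in _ == X]E take_drop_window // addnC.
Qed.

Section Mean.
Variables (R : realType) (P : A -> seq A -> R).
Hypothesis hP : permissible theta P.

Lemma image_mean_block (u v w : seq A) i : prefix v (drop i u) ->
  image_mean theta P u (fun x =>
    (take (image_len theta v) (drop (block_start u i) x) == w)%:R) =
  word_prob theta P v w.
Proof.
move=> /prefixP [z uE]; rewrite -{1}(cat_take_drop i u) uE (image_mean_cat hP).
rewrite -[RHS](image_mean_cst hP _ (take i u)).
apply: eq_image_mean => x xu; rewrite (image_mean_cat hP) (word_prob_mean hP).
apply: eq_image_mean => y yv; rewrite -[RHS](image_mean_cst hP _ z).
apply: eq_image_mean => t _.
rewrite /block_start -(size_word_image hcomp xu) drop_size_cat //.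
by rewrite -(size_word_image hcomp yv) take_size_cat.
Qed.

Lemma image_mean_occ_inner (u w v : seq A) p :
  (0 < size v)%N -> (p + image_len theta v <= size w)%N ->
  (forall x q, x \in word_image theta u -> take (size w) (drop q x) = w ->
     (q + size w <= size x)%N ->
     exists2 i, block_start u i = (q + p)%N & prefix v (drop i u)) ->
  image_mean theta P u (fun x => (occ w x)%:R) <=
  word_prob theta P v (take (image_len theta v) (drop p w)) * (occ v u)%:R.
Proof.
move=> v0 pv h; set w' := take _ (drop p w).
apply: (@le_trans _ _ (image_mean theta P u (fun x =>
   \sum_(i <- iota 0 (size u)) (prefix v (drop i u))%:R *
     (take (image_len theta v) (drop (block_start u i) x) == w')%:R))).
  apply: (image_mean_le hP) => x xu.
  under eq_bigr do rewrite -natrM; rewrite -natr_sum ler_nat.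
  by apply: occ_le_inner => // q; apply: h.
rewrite (image_mean_sum theta P) /occ -sum1_count [in leRHS]big_mkcond natr_sum
  mulr_sumr.
apply: ler_sum => i _; rewrite image_meanZ.
by case: ifP => vi; rewrite ?mul0r ?mulr0 // mul1r mulr1 image_mean_block.
Qed.

End Mean.
End Core.

(** * Moments and exponential growth *)

Section RealBounds.
Variable R : realType.

(** From [1 - y <= expR (- y)] the exponential is at most [1 / (1 - y)], and [(1 - y) * (1 + y + 2 *
    y ^+ 2) = 1 + y ^+ 2 * (1 - 2 * y)]. *)
Lemma expR_le_quadratic (y : R) : `|y| <= 2^-1 -> expR y <= 1 + y + 2 * y ^+ 2.
Proof.
rewrite ler_norml => /andP[y1 y2].
have h := expR_ge1Dx (- y); have y0 : 0 < 1 - y by lra.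
rewrite -[expR y]invrK -expRN; apply: (@le_trans _ _ (1 - y)^-1).
  by rewrite lef_pV2 // posrE ?expR_gt0.
rewrite -[(1 - y)^-1]mul1r ler_pdivrMr //.
have : 0 <= y ^+ 2 * (1 - 2 * y) by rewrite mulr_ge0 ?sqr_ge0 //; lra.
by rewrite !expr2; nra.
Qed.

(* The recursion [Z N ~ Z (N / lam) * exp (b N / lam)] has exponential growth
   rate [b / (lam - 1)], the sum of [b / lam ^ i] over [i >= 1]. *)
Lemma renormalised_growth (Z : nat -> R) (lam b c : R) :
  1 < lam -> b / (lam - 1) < c -> (forall N, 0 <= Z N) ->
  (forall d, 0 < d -> \forall N \near \oo, exists n : nat,
     `|n%:R - N%:R / lam| <= d * N%:R /\
     Z N <= expR (d * N%:R) * Z n * expR (b * n%:R)) ->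
  exists2 K, 0 < K & forall N, Z N <= K * expR (c * N%:R).
Proof.
move=> l1 bc Z0 hrec; have l0 : 0 < lam by apply: lt_trans l1.
have lam1 : 0 < lam - 1 by rewrite subr_gt0.
(* The induction closes when [(b + c) / lam < c], which is the hypothesis on [c] rewritten. The
   slack [g] pays for the prefactor and for the error in [n], whose weights add up to [e]. *)
pose g := c - (b + c) / lam.
have g0 : 0 < g.
  rewrite /g subr_gt0 ltr_pdivrMr //.
  by move: bc; rewrite ltr_pdivrMr // mulrBr mulr1 ltrBrDr.
pose e := 1 + `|b + c|; have e0 : 0 < e by rewrite ltr_wpDr.
have il1 : lam^-1 < 1 by rewrite invf_lt1.
(* The first bound fits the errors into the slack, the second ensures [n < N]. *)
pose d := Num.min (g / e) ((1 - lam^-1) / 2).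
have d0 : 0 < d by rewrite lt_min !divr_gt0 // subr_gt0.
have de : d * e <= g by rewrite -ler_pdivlMr // ge_min lexx.
have dl : lam^-1 + d < 1.
  have : d <= (1 - lam^-1) / 2 by rewrite ge_min lexx orbT.
  lra.
have [N0 _ hN0] := hrec d d0.
pose K := 1 + \sum_(j < N0.+1) Z j * expR (- (c * j%:R)).
have S0 (P : pred 'I_N0.+1) : 0 <= \sum_(j < N0.+1 | P j) Z j * expR (- (c * j%:R)).
  by apply: sumr_ge0 => j _; rewrite mulr_ge0 ?expR_ge0.
exists K; first by rewrite ltr_wpDr.
elim/ltn_ind => N IH; case: (ltnP N N0.+1) => hN.
  rewrite -ler_pdivrMr ?expR_gt0 // -expRN /K (bigD1 (Ordinal hN)) //=.
  by rewrite addrCA lerDl addr_ge0.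
have [n [/ler_normlP [n1 n2] hZ]] := hN0 N (ltnW hN).
have NR : 0 < N%:R :> R by rewrite ltr0n (leq_trans _ hN).
have nN : (n < N)%N.
  rewrite -(ltr_nat R); apply: (@le_lt_trans _ _ ((lam^-1 + d) * N%:R)).
    by move: n2; rewrite mulrDl [lam^-1 * _]mulrC; lra.
  by rewrite -[ltRHS]mul1r ltr_pM2r.
apply: (le_trans hZ).
apply: (@le_trans _ _ (expR (d * N%:R) * (K * expR (c * n%:R)) * expR (b * n%:R))).
  by rewrite ler_wpM2r ?expR_ge0 // ler_wpM2l ?expR_ge0 // IH.
have -> : expR (d * N%:R) * (K * expR (c * n%:R)) * expR (b * n%:R) =
    K * expR (d * N%:R + (b + c) * n%:R).
  by rewrite (mulrDl b c) !expRD; ring.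
rewrite ler_wpM2l ?addr_ge0 ?S0 // ler_expR.
have h : (b + c) * (n%:R - N%:R / lam) <= `|b + c| * (d * N%:R).
  apply: le_trans (ler_norm _) _; rewrite normrM ler_wpM2l //.
  by apply/ler_normlP.
have h2 : d * e * N%:R <= g * N%:R by rewrite ler_wpM2r // ltW.
have -> : c * N%:R = g * N%:R + (b + c) * (N%:R / lam).
  by rewrite /g mulrBl mulrA mulrAC subrK.
apply: le_trans (lerD h2 (lexx _)).
move: h; rewrite mulrBr lerBlDr => h; apply: le_trans (lerD (lexx _) h) _.
by rewrite /e le_eqVlt; apply/orP; left; apply/eqP; ring.
Qed.

End RealBounds.

Section MomentBound.
Variables (R : realType) (A : finType) (theta : substitution A).
Variables (P Q : A -> seq A -> R).
Hypotheses (hP : permissible theta P) (hQ : permissible theta Q).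

Definition cross_entropy (a : A) : R := \sum_(s <- theta a) - (Q a s * ln (P a s)).

Definition moment (t : R) (a : A) : R := \sum_(s <- theta a) Q a s * P a s `^ t.

Lemma moment_ge0 t a : 0 <= moment t a.
Proof. by apply: sumr_ge0 => s _; rewrite mulr_ge0 ?powR_ge0 ?(permissible_ge0 hQ).
  Qed.

(** Second-order expansion of [expR (t * ln (P a s))]: averaging over [Q] gives the cross entropy as
    linear term. *)
Lemma moment_le (eps : R) : 0 < eps -> exists2 t0, 0 < t0 &
  forall t a, `|t| <= t0 -> moment t a <= expR (- t * cross_entropy a + eps * `|t|).
Proof.
move=> e0; pose B := 1 + \sum_a \sum_(s <- theta a) `|ln (P a s)|.
have B1 : 1 <= B.
  by rewrite lerDl; apply: sumr_ge0 => a _; apply: sumr_ge0.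
have B0 : 0 < B by apply: lt_le_trans B1.
have hB a s : s \in theta a -> `|ln (P a s)| <= B.
  move=> sa; rewrite /B (bigD1 a) //= (big_fsetD1 s) //= addrCA -addrA lerDl.
  by rewrite !addr_ge0 //; apply: sumr_ge0 => // b _; apply: sumr_ge0.
(* The first entry makes the quadratic bound applicable, the second makes its remainder at most
   [eps * |t|]. *)
exists (Num.min (2^-1 / B) (eps / (2 * B ^+ 2))).
  by rewrite lt_min !divr_gt0 // ?mulr_gt0 ?exprn_gt0.
move=> t a; rewrite le_min => /andP[t1 t2].
have [pos _ Q1] := hQ a.
have bound s : s \in theta a ->
    P a s `^ t <= 1 + t * ln (P a s) + eps * `|t|.
  move=> sa; have [/(_ _ sa) P0 _ _] := hP a.
  rewrite /powR gt_eqF //; apply: le_trans (expR_le_quadratic _) _.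
    rewrite normrM; apply: le_trans (ler_wpM2l _ (hB _ _ sa)) _ => //.
    by rewrite -ler_pdivlMr.
  rewrite lerD2l exprMn -[t ^+ 2]real_normK ?num_real // expr2.
  apply: (@le_trans _ _ (2 * (`|t| * `|t| * B ^+ 2))).
    rewrite ler_wpM2l // ler_wpM2l ?mulr_ge0 // -[ln _ ^+ 2]real_normK ?num_real //.
    by rewrite lerXn2r ?nnegrE ?hB ?(ltW B0).
  rewrite ler_pdivlMr ?mulr_gt0 ?exprn_gt0 // in t2.
  have -> : 2 * (`|t| * `|t| * B ^+ 2) = `|t| * (2 * B ^+ 2) * `|t| by ring.
  by rewrite ler_wpM2r.
apply: le_trans (expR_ge1Dx _).
apply: (@le_trans _ _ (\sum_(s <- theta a)
    Q a s * (1 + t * ln (P a s) + eps * `|t|))).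
  rewrite /moment big_seq [leRHS]big_seq ler_sum // => s sa.
  by rewrite ler_wpM2l ?(permissible_ge0 hQ) // bound.
rewrite le_eqVlt; apply/orP; left; apply/eqP.
under eq_bigr do rewrite !mulrDr mulr1.
rewrite !big_split /= Q1 -mulr_suml Q1 mul1r -addrA; congr (_ + (_ + _)).
by rewrite /cross_entropy mulr_sumr; apply: eq_bigr => s _; ring.
Qed.

End MomentBound.

Section WordSums.
Variables (R : realType) (A : finType).

Lemma sum_words_prefix N (F : seq A -> R) (y : seq A) : (N <= size y)%N ->
  \sum_(w <- words A N) (prefix w y)%:R * F w = F (take N y).
Proof.
elim: N F y => [|N IH] F y; first by rewrite /= big_seq1 prefix0s mul1r take0.
case: y => // b y; rewrite ltnS => Ny; rewrite sum_wordsS (bigD1 b) //=.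
rewrite [X in _ + X]big1 ?addr0; last first.
  by move=> a /negPf ab; apply: big1 => w _; rewrite ab mul0r.
by rewrite eqxx /= (IH (fun w => F (b :: w))).
Qed.

(** The [N - l] letters outside the inner block are free. This crude count is affordable since
    [N - l] will be a small fraction of [N]. *)
Lemma sum_words_sub N p l (F : seq A -> R) : (p + l <= N)%N ->
  \sum_(w <- words A N) F (take l (drop p w)) =
  (#|A| ^ (N - l))%:R * \sum_(w <- words A l) F w.
Proof.
move=> plN; have -> : N = (p + (l + (N - l - p)))%N by lia.
have -> : (p + (l + (N - l - p)) - l = p + (N - l - p))%N by lia.
rewrite sum_wordsD; under eq_bigr do rewrite sum_wordsD.
rewrite expnD natrM -!size_words.
have cst (I : Type) (s : seq I) (x : R) : (size s)%:R * x = \sum_(i <- s) x.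
  by rewrite big_const_seq count_predT iter_addr_0 mulr_natl.
rewrite -mulrA !cst big_seq [RHS]big_seq; apply: eq_bigr => x.
rewrite mem_words => /eqP sx; rewrite exchange_big /=; apply: eq_bigr => z _.
rewrite big_seq [RHS]big_seq; apply: eq_bigr => y; rewrite mem_words => /eqP sy.
by rewrite drop_size_cat // take_size_cat.
Qed.

End WordSums.

(** * Inequalities between word masses *)

Section WordMeasure.
Variables (R : realType) (A : finType) (a0 : A) (theta : substitution A).
Hypotheses (hprim : subst_primitive R theta) (hcomp : compatible theta).
Variables (lam : R) (r : A -> R).
Hypotheses (hlam : PF_eigenvalue theta lam)
  (hr : PF_right_eigenvector theta lam r).

Section OneFrequency.
Variables (P : A -> seq A -> R) (m : seq A -> R).
Hypotheses (hP : permissible theta P) (hm : word_frequency a0 theta P m).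

Lemma frequency_illegal v : ~ legal theta v -> m v = 0.
Proof.
move=> nv; apply/eqP; rewrite eq_le (frequency_ge0 hcomp hP hm) andbT.
have := @frequency_le _ _ _ _ hprim hcomp _ _ hlam hr _ _ hP hm unit [::]
  (fun=> 0) (fun=> v) v 0.
rewrite !big_nil; apply=> u lu; rewrite big_nil addr0.
rewrite -(image_mean_cst hP 0 u); apply: (image_mean_le hP) => x xu.
by rewrite (occ_illegal (legal_image lu xu) nv).
Qed.

Lemma occ_infix (v w x : seq A) : v != [::] -> infix v w -> (occ w x <= occ v x)%N.
Proof.
move=> v0 /infixP [y [z wE]].
rewrite /occ -!size_filter -(size_map (addn (size y))); apply: uniq_leq_size.
  by rewrite map_inj_uniq ?filter_uniq ?iota_uniq //; exact: addnI.
move=> q hq; move/mapP: hq => [j].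
rewrite mem_filter mem_iota add0n /= => /andP[/prefixP [t E] jx] ->.
have e : drop (size y + j) x = v ++ (z ++ t).
  by rewrite -drop_drop E wE -!catA drop_size_cat.
rewrite mem_filter mem_iota add0n e prefix_prefix /=.
rewrite ltnNge; apply/negP => h; move: e; rewrite drop_oversize // => /esym.
by case: (v) v0.
Qed.

Lemma frequency_infix (v w : seq A) : v != [::] -> infix v w -> m w <= m v.
Proof.
move=> v0 vw; apply: (ler_cvg_to (@hm w) (@hm v)); near=> k.
rewrite ler_wpM2r ?invr_ge0 //.
  by rewrite (iter_mean_size hP hcomp).
by apply: (iter_mean_le hP) => x _; rewrite ler_nat occ_infix.
Unshelve. all: by end_near.
Qed.

Lemma frequency_image_ge (v x : seq A) :
  word_prob theta P v x / (max_size theta)%:R * m v <= m x.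
Proof.
apply: (frequency_ge hcomp hP hm); first exact: word_prob_ge0.
by move=> u _; apply: (image_mean_occ_ge hcomp hP).
Qed.

(** Positivity passes from letters to their iterated images by the one-step lower bound, and from
    there to subwords. *)
Lemma frequency_gt0 (w : seq A) : w != [::] -> legal theta w -> 0 < m w.
Proof.
move=> w0 [k [a [W Wk wW]]]; apply: lt_le_trans (frequency_infix w0 wW).
elim: k W Wk {wW} => [|k IH] W.
  by rewrite in_fset1 => /eqP ->; exact: (frequency_letter_gt0 hprim hcomp hlam hr
    hP hm).
move=> /iter_imageSP [u /IH u0]; rewrite (word_imageP hP) => Wu.
apply: lt_le_trans (frequency_image_ge u W).
by rewrite mulr_gt0 // divr_gt0 // ltr0n (max_size_gt0 a0).
Qed.

Lemma frequency_inner_le (w v : seq A) (p : nat) :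
  (0 < size v)%N -> (p + image_len theta v <= size w)%N ->
  (forall u x q, legal theta u -> x \in word_image theta u ->
     take (size w) (drop q x) = w -> (q + size w <= size x)%N ->
     exists2 i, block_start theta u i = (q + p)%N & prefix v (drop i u)) ->
  m w <= word_prob theta P v (take (image_len theta v) (drop p w)) * m v.
Proof.
move=> v0 pv h.
have := @frequency_le _ _ _ _ hprim hcomp _ _ hlam hr _ _ hP hm unit [:: tt]
  (fun=> word_prob theta P v (take (image_len theta v) (drop p w)))
  (fun=> v) w 0.
rewrite big_seq1; apply=> u lu; rewrite big_seq1 addr0.
by apply: (image_mean_occ_inner hcomp hP) => // x q; apply: h.
Qed.

Lemma frequency_cover_le (w : seq A) n : (0 < n)%N ->
  (forall v, legal theta v -> size v = n ->
     (size w + max_size theta <= image_len theta v)%N) ->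
  m w <= \sum_(v <- words A n) \sum_(q <- iota 0 (max_size theta))
    image_mean theta P v (fun x => (prefix w (drop q x))%:R) * m v.
Proof.
move=> n0 hn.
have := @frequency_le _ _ _ _ hprim hcomp _ _ hlam hr _ _ hP hm (seq A * nat)%type
  [seq (v, q) | v <- words A n, q <- iota 0 (max_size theta)]
  (fun vq => image_mean theta P vq.1 (fun x => (prefix w (drop vq.2 x))%:R))
  fst w (max_size theta * n)%:R.
rewrite big_allpairs_dep /=; apply=> u lu; rewrite big_allpairs_dep /=.
exact: (image_mean_occ_le hcomp hP).
Qed.

End OneFrequency.

Lemma image_len_frequency (eta : R) : 0 < eta -> exists2 C, 0 <= C &
  forall v, legal theta v ->
  `|(image_len theta v)%:R - lam * (size v)%:R| <= eta * (size v)%:R + C.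
Proof.
move=> e0; have [C C0 hC] := letter_frequency hcomp hprim hlam hr a0
  (fun a => (image_size theta a)%:R) e0.
exists C => // v lv; have := hC v lv.
by rewrite -(PF_eigenvalueE hr) -natr_sum.
Qed.

End WordMeasure.

(** * Recursion for the partition sums *)

Section Partition.
Variables (R : realType) (A : finType) (a0 : A) (theta : substitution A).
Hypotheses (hprim : subst_primitive R theta) (hcomp : compatible theta)
  (hrec : recognisable theta).
Variables (lam : R) (r : A -> R).
Hypotheses (hlam : PF_eigenvalue theta lam)
  (hr : PF_right_eigenvector theta lam r).
Variables (P Q : A -> seq A -> R) (mP mQ : seq A -> R).
Hypotheses (hP : permissible theta P) (hQ : permissible theta Q)
  (hmP : word_frequency a0 theta P mP) (hmQ : word_frequency a0 theta Q mQ).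

Definition mean_cross_entropy : R :=
  \sum_a r a * cross_entropy theta P Q a.

(** One half of [eps] covers the second-order error of each moment, the other the deviation of the
    letter counts of [v] from [r]. *)
Lemma prod_moment_le (eps : R) : 0 < eps -> exists2 t0, 0 < t0 &
  forall t, `|t| <= t0 -> exists2 C, 0 <= C & forall v, legal theta v ->
  \prod_(a <- v) moment theta P Q t a <=
  expR ((- t * mean_cross_entropy + eps * `|t|) * (size v)%:R + C).
Proof.
move=> e0; have e20 : 0 < eps / 2 by rewrite divr_gt0.
have [t0 t00 ht] := moment_le hP hQ e20.
have [C C0 hC] := letter_frequency hcomp hprim hlam hr a0
  (cross_entropy theta P Q) e20.
exists t0 => // t tt0; exists (C * `|t|); first by rewrite mulr_ge0.
move=> v lv; apply: (@le_trans _ _ (expR (\sum_(a <- v)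
    (- t * cross_entropy theta P Q a + eps / 2 * `|t|)))).
  rewrite expR_sum; apply: ler_prod => a _.
  by rewrite moment_ge0 //= ht.
rewrite ler_expR big_split /= -mulr_sumr big_const_seq count_predT iter_addr_0.
rewrite -[_ *+ size v]mulr_natr.
have := hC v lv; rewrite -/mean_cross_entropy; move: (size v)%:R => n.
move: (\sum_(a <- v) _) => S; move: mean_cross_entropy => H h.
have : - t * (S - H * n) <= `|t| * (eps / 2 * n + C).
  by apply: le_trans (ler_norm _) _; rewrite normrM normrN ler_wpM2l.
lra.
Qed.

(** The moment generating function of the log-mass under [Q]; illegal words drop out because [mQ]
    vanishes on them. *)
Definition partition_sum (t : R) (N : nat) : R :=
  \sum_(w <- words A N) mQ w * mP w `^ t.

Lemma partition_sum_ge0 t N : 0 <= partition_sum t N.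
Proof.
by apply: sumr_ge0 => w _; rewrite mulr_ge0 ?powR_ge0 ?(frequency_ge0 hcomp hQ hmQ).
Qed.

Lemma sum_words_mean (v : seq A) (F : seq A -> R) :
  \sum_(w <- words A (image_len theta v)) word_prob theta Q v w * F w =
  image_mean theta Q v F.
Proof.
under eq_bigr do rewrite (word_prob_mean hQ) mulrC -image_meanZ.
rewrite -(image_mean_sum theta Q); apply: eq_image_mean => y yv.
have sy := size_word_image hcomp yv.
rewrite -[RHS](_ : F (take (image_len theta v) y) = _); last first.
  by rewrite -sy take_size.
rewrite -sum_words_prefix ?sy // big_seq [RHS]big_seq; apply: eq_bigr => w.
rewrite mem_words => /eqP sw; rewrite mulrC prefixE sw -sy take_size.
by rewrite eq_sym.
Qed.

Variables (t b C : R).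
Hypothesis prod_le : forall v, legal theta v ->
  \prod_(a <- v) moment theta P Q t a <= expR (b * (size v)%:R + C).

Lemma partition_sum_step n :
  \sum_(v <- words A n) mQ v * mP v `^ t * \prod_(a <- v) moment theta P Q t a
  <= partition_sum t n * expR (b * n%:R) * expR C.
Proof.
rewrite /partition_sum -mulrA mulr_suml big_seq [leRHS]big_seq ler_sum // => v.
rewrite mem_words => /eqP <-.
have [lv|nlv] := pselect (legal theta v); last first.
  by rewrite (frequency_illegal hprim hcomp hlam hr hQ hmQ nlv) !mul0r.
by rewrite -expRD ler_wpM2l ?prod_le // mulr_ge0 ?powR_ge0
  ?(frequency_ge0 hcomp hQ hmQ).
Qed.

(** The mass [mQ w] is spread over the [n]-blocks whose images cover [w]. On each of them [mP w] is
    bounded below, and [t < 0] reverses this. One factor [max_size theta] counts offsets, the power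
    of its inverse comes from [frequency_image_ge]. *)
Lemma partition_sum_neg (N n : nat) : t < 0 -> (0 < n)%N -> (0 < N)%N ->
  (forall v, legal theta v -> size v = n ->
     (N + max_size theta <= image_len theta v)%N) ->
  partition_sum t N <=
  (max_size theta)%:R * (max_size theta)%:R^-1 `^ t * expR C *
  (partition_sum t n * expR (b * n%:R)).
Proof.
move=> t0 n0 N0 hn; set ms := (max_size theta)%:R.
have ms0 : 0 < ms by rewrite ltr0n (max_size_gt0 a0).
pose K := ms^-1 `^ t.
have bound v x q : legal theta v -> size v = n -> x \in word_image theta v ->
    (q < max_size theta)%N ->
    mP (take N (drop q x)) `^ t <= word_prob theta P v x `^ t * (K * mP v `^ t).
  move=> lv sv xv qm; have lx := legal_image lv xv.
  have szx : (N + max_size theta <= size x)%N.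
    by rewrite (size_word_image hcomp xv) hn.
  have nz (y : seq A) : (0 < size y)%N -> y != [::] by case: y.
  have sy : size (take N (drop q x)) = N.
    by rewrite size_takel // size_drop; lia.
  have y0 : 0 < mP (take N (drop q x)).
    apply: (frequency_gt0 hprim hcomp hlam hr hP hmP); first by rewrite nz ?sy.
    by apply/legal_take/legal_drop.
  have v0 : 0 < mP v.
    by apply: (frequency_gt0 hprim hcomp hlam hr hP hmP) => //; rewrite nz ?sv.
  have p0 : 0 < word_prob theta P v x by rewrite -(word_imageP hP).
  have yx : infix (take N (drop q x)) x.
    by apply: infix_trans (prefixW (prefix_take _ _)) (suffixW (suffix_drop _ _)).
  have h : word_prob theta P v x / ms * mP v <= mP (take N (drop q x)).
    apply: le_trans (frequency_infix hcomp hP hmP _ yx); last by rewrite nz ?sy.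
    exact: (frequency_image_ge hcomp hP hmP).
  rewrite mulrA -!powRM ?mulr_ge0 ?invr_ge0 ?(ltW p0) ?(ltW v0) ?(ltW ms0) //.
  have z0 : 0 < word_prob theta P v x / ms * mP v by rewrite !mulr_gt0 ?invr_gt0.
  rewrite /powR !gt_eqF // ler_expR.
  by rewrite ler_wnM2l ?(ltW t0) // ler_ln.
apply: (@le_trans _ _ (\sum_(w <- words A N) \sum_(v <- words A n)
    \sum_(q <- iota 0 (max_size theta))
    image_mean theta Q v (fun x => (prefix w (drop q x))%:R) * mQ v * mP w `^ t)).
  rewrite /partition_sum big_seq [leRHS]big_seq ler_sum // => w.
  rewrite mem_words => /eqP sw.
  apply: (@le_trans _ _ ((\sum_(v <- words A n) \sum_(q <- iota 0 (max_size theta))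
    image_mean theta Q v (fun x => (prefix w (drop q x))%:R) * mQ v) * mP w `^ t)).
    rewrite ler_wpM2r ?powR_ge0 //.
    apply: (frequency_cover_le hprim hcomp hlam hr hQ hmQ n0) => v.
    by rewrite sw; exact: hn.
  by rewrite mulr_suml ler_sum // => v _; rewrite mulr_suml.
rewrite exchange_big /=.
apply: (@le_trans _ _ (\sum_(v <- words A n) ms * K *
   (mQ v * mP v `^ t * \prod_(a <- v) moment theta P Q t a))); last first.
  rewrite -mulr_sumr -!mulrA ler_wpM2l ?(ltW ms0) // ler_wpM2l ?powR_ge0 //.
  by rewrite [expR C * _]mulrC partition_sum_step.
rewrite big_seq [leRHS]big_seq ler_sum // => v; rewrite mem_words => /eqP sv.
have [lv|nlv] := pselect (legal theta v); last first.
  rewrite (frequency_illegal hprim hcomp hlam hr hQ hmQ nlv) !(mul0r,mulr0).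
  by rewrite big1 // => w _; rewrite big1 // => q _; rewrite mulr0 mul0r.
rewrite exchange_big /=.
have -> : ms * K * (mQ v * mP v `^ t * \prod_(a <- v) moment theta P Q t a) =
   \sum_(q <- iota 0 (max_size theta))
     (mQ v * (K * mP v `^ t) * \prod_(a <- v) moment theta P Q t a).
  rewrite big_const_seq count_predT iter_addr_0 size_iota -[RHS]mulr_natl -/ms.
  by ring.
rewrite [leLHS]big_seq [leRHS]big_seq ler_sum // => q; rewrite mem_iota add0n /= =>
  qm.
have -> : \sum_(w <- words A N)
    image_mean theta Q v (fun x => (prefix w (drop q x))%:R) * mQ v * mP w `^ t =
  mQ v * image_mean theta Q v (fun x => \sum_(w <- words A N)
    mP w `^ t * (prefix w (drop q x))%:R).
  rewrite (image_mean_sum theta Q) mulr_sumr; apply: eq_bigr => w _.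
  by rewrite image_meanZ; ring.
rewrite -mulrA ler_wpM2l ?(frequency_ge0 hcomp hQ hmQ) //.
rewrite -(image_mean_word_prob_powR hcomp hP hQ) -image_meanZ.
apply: (image_mean_le hQ) => x xv.
under eq_bigr do rewrite mulrC.
(* Given the image [x] and the offset [q], only one word of length [N] is counted, so the sum over
   [w] collapses. *)
rewrite sum_words_prefix; first by rewrite mulrC bound.
by rewrite size_drop (size_word_image hcomp xv); move: (hn v lv sv); lia.
Qed.

Lemma partition_sum_pos : 0 < t -> exists kap, forall N n d,
  (1 < N)%N -> (0 < n)%N ->
  (forall v, legal theta v -> (size v <= n)%N ->
     (image_len theta v + kap <= N)%N) ->
  (forall v, legal theta v -> size v = n -> (N <= image_len theta v + d)%N) ->
  partition_sum t N <=
  N.+1%:R * (#|A| ^ d)%:R * expR C * (partition_sum t n * expR (b * n%:R)).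
Proof.
move=> t0; have [kap hkap] := inner_preimage a0 hcomp hrec.
exists kap => N n d N1 n0 hn hd.
pose G v w' := (word_prob theta Q v w' * mQ v) *
  (word_prob theta P v w' * mP v) `^ t.
have G0 v w' : 0 <= G v w'.
  by rewrite mulr_ge0 ?powR_ge0 // mulr_ge0 ?(word_prob_ge0 hQ) //
    (frequency_ge0 hcomp hQ hmQ).
have term0 p w v : 0 <= (if (p + image_len theta v <= N)%N then
    G v (take (image_len theta v) (drop p w)) else 0) by case: ifP.
(* The inner block and its position depend on [w]; summing over all candidates removes the
   dependence, and the positions cost the factor [N.+1]. *)
apply: (@le_trans _ _ (\sum_(w <- words A N) \sum_(p <- iota 0 N.+1)
   \sum_(v <- words A n) (if (p + image_len theta v <= N)%N then
     G v (take (image_len theta v) (drop p w)) else 0))).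
  rewrite /partition_sum [leLHS]big_seq [leRHS]big_seq ler_sum // => w.
  rewrite mem_words => /eqP sw.
  have [lw|nlw] := pselect (legal theta w); last first.
    rewrite (frequency_illegal hprim hcomp hlam hr hQ hmQ nlw) mul0r.
    by rewrite sumr_ge0 // => p _; rewrite sumr_ge0.
  have [||p [v [sv lv pv h]]] := hkap w n lw _ n0; rewrite ?sw //.
  have vn : v \in words A n by rewrite mem_words sv.
  have pN : p \in iota 0 N.+1.
    rewrite mem_iota add0n /= ltnS (leq_trans _ (leq_trans pv _)) ?sw //.
    exact: leq_addr.
  rewrite (big_rem p) //= (big_rem v) //= -sw pv.
  apply: (@le_trans _ _ (G v (take (image_len theta v) (drop p w)))).
    have v0 : (0 < size v)%N by rewrite sv.
    (* The same [v] and [p] serve both measures, since [h] is purely combinatorial. *)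
    have inner P' m (hP' : permissible theta P')
        (hm : word_frequency a0 theta P' m) :=
      frequency_inner_le hprim hcomp hlam hr hP' hm v0 pv h.
    apply: ler_pM; rewrite ?powR_ge0 ?(frequency_ge0 hcomp hQ hmQ) //.
      exact: inner.
    apply: ge0_ler_powR; rewrite ?(ltW t0) ?nnegrE //.
    - exact: (frequency_ge0 hcomp hP hmP).
    - by rewrite mulr_ge0 ?(word_prob_ge0 hP) // (frequency_ge0 hcomp hP hmP).
    - exact: inner.
  rewrite -addrA lerDl addr_ge0 ?sumr_ge0 // => [v' _|q _].
    by rewrite sw.
  by rewrite sumr_ge0 // => v' _; rewrite sw.
rewrite exchange_big /=.
apply: (@le_trans _ _ (\sum_(p <- iota 0 N.+1) (#|A| ^ d)%:R *
   (partition_sum t n * expR (b * n%:R) * expR C))); last first.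
  rewrite big_const_seq count_predT iter_addr_0 size_iota -[leLHS]mulr_natl.
  by rewrite le_eqVlt; apply/orP; left; apply/eqP; ring.
apply: ler_sum => p _; rewrite exchange_big /=.
have A0 : (0 < #|A|)%N by apply/card_gt0P; exists a0.
apply: (@le_trans _ _ ((#|A| ^ d)%:R * \sum_(v <- words A n)
    mQ v * mP v `^ t * \prod_(a <- v) moment theta P Q t a)); last first.
  by rewrite ler_wpM2l // partition_sum_step.
rewrite mulr_sumr [leLHS]big_seq [leRHS]big_seq ler_sum // => v.
rewrite mem_words => /eqP sv.
have rhs0 : 0 <= mQ v * mP v `^ t * \prod_(a <- v) moment theta P Q t a.
  rewrite !mulr_ge0 ?powR_ge0 ?(frequency_ge0 hcomp hQ hmQ) //.
  by apply: prodr_ge0 => a _; apply: (moment_ge0 P hQ).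
case: (boolP (p + image_len theta v <= N)%N) => pv; last
  by rewrite big1 // mulr_ge0.
rewrite sum_words_sub //.
have -> : \sum_(w <- words A (image_len theta v)) G v w =
    mQ v * mP v `^ t * \prod_(a <- v) moment theta P Q t a.
  rewrite -(image_mean_word_prob_powR hcomp hP hQ) -sum_words_mean mulr_sumr.
  apply: eq_bigr => w _; rewrite /G powRM ?(word_prob_ge0 hP) //.
    by ring.
  exact: (frequency_ge0 hcomp hP hmP).
have [lv|nlv] := pselect (legal theta v); last first.
  by rewrite (frequency_illegal hprim hcomp hlam hr hQ hmQ nlv) !(mul0r,mulr0).
rewrite ler_wpM2r // ler_nat leq_pexp2l // leq_subLR; exact: hd.
Qed.

End Partition.

(** With [x = d * N / 4] one has [(N + 1) * c <= 2 * N * c <= x ^+ 2], and [x <= expR x]. *)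
Lemma linear_le_expR (R : realType) (d N c : R) : 1 <= N -> 0 < d ->
  32 * c <= d ^+ 2 * N -> 0 <= c -> (N + 1) * c <= expR (d * N / 2).
Proof.
move=> N1 d0 h c0; pose x := d * N / 4.
have N0 : 0 <= N by lra.
have x0 : 0 <= x by rewrite /x divr_ge0 // mulr_ge0 // ltW.
have -> : d * N / 2 = x + x by rewrite /x; field.
rewrite expRD; have h1 : x <= expR x by apply: le_trans (expR_ge1Dx x); lra.
apply: (@le_trans _ _ (x * x)); last by rewrite ler_pM.
have h2 : (N + 1) * c <= 2 * N * c by rewrite ler_wpM2r //; lra.
have h3 : 32 * c * N <= d ^+ 2 * N * N by rewrite ler_wpM2r.
have h4 : x * x = d ^+ 2 * N * N / 16 by rewrite /x; field.
by rewrite h4; apply: (le_trans h2); clear -h3; lra.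
Qed.

Section Recursion.
Variables (R : realType) (A : finType) (a0 : A) (theta : substitution A).
Hypotheses (hprim : subst_primitive R theta) (hcomp : compatible theta)
  (hrec : recognisable theta).
Variables (lam : R) (r : A -> R).
Hypotheses (hlam : PF_eigenvalue theta lam)
  (hr : PF_right_eigenvector theta lam r).
Variables (P Q : A -> seq A -> R) (mP mQ : seq A -> R).
Hypotheses (hP : permissible theta P) (hQ : permissible theta Q)
  (hmP : word_frequency a0 theta P mP) (hmQ : word_frequency a0 theta Q mQ).

Variables (t b C : R).
Hypothesis prod_le : forall v, legal theta v ->
  \prod_(a <- v) moment theta P Q t a <= expR (b * (size v)%:R + C).

Notation Z := (partition_sum mP mQ).

Lemma partition_recursion_neg : t < 0 -> forall d, 0 < d ->
  \forall N \near \oo, exists n : nat,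
    `|n%:R - N%:R / lam| <= d * N%:R /\
    Z t N <= expR (d * N%:R) * Z t n * expR (b * n%:R).
Proof.
move=> t0 d d0; have l1 := PF_eigenvalue_gt1 hprim hlam.
have l0 : 0 < lam by apply: lt_trans l1.
pose il := lam^-1; have il0 : 0 < il by rewrite invr_gt0.
have lil : lam * il = 1 by rewrite mulfV // gt_eqF.
(* About [s * N] letters are slightly more than [N / lam]; [eta] is such that their images still
   have length about [(1 + lam * d / 4) * N] in the worst case, enough to cover [w] at every
   offset. *)
pose s := il + d / 2; have s0 : 0 < s by rewrite addr_gt0 // divr_gt0.
have ld0 : 0 < lam * d by rewrite mulr_gt0.
pose eta := lam * d / 4 / s; have eta0 : 0 < eta by rewrite !divr_gt0.
have etas : eta * s = lam * d / 4 by rewrite mulfVK // gt_eqF.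
have ls : (lam - eta) * s = 1 + lam * d / 4.
  by rewrite mulrBl etas /s mulrDr lil; field.
have le0 : 0 < lam - eta by rewrite -(pmulr_lgt0 _ s0) ls; lra.
have [C1 C10 hC1] := image_len_frequency a0 hprim hcomp hlam hr eta0.
set ms := (max_size theta)%:R : R.
pose K := ms * ms^-1 `^ t * expR C.
near=> N.
have n1 : 2 <= d * N%:R.
  rewrite mulrC -ler_pdivrMr //; near: N; exact: nbhs_infty_ger.
have n2 : 4 * (C1 + ms) <= lam * d * N%:R.
  rewrite [leRHS]mulrC -ler_pdivrMr //; near: N; exact: nbhs_infty_ger.
have n3 : K <= d * N%:R.
  rewrite [leRHS]mulrC -ler_pdivrMr //; near: N; exact: nbhs_infty_ger.
have N0 : (0 < N)%N by near: N; exact: nbhs_infty_gt.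
have NR : 0 < N%:R :> R by rewrite ltr0n.
have sN : 0 <= s * N%:R by rewrite mulr_ge0 // ltW.
have /andP[nlo nhi] := truncn_itv sN.
pose n := (Num.truncn (s * N%:R)).+1.
have nE : n%:R = (Num.truncn (s * N%:R))%:R + 1 :> R by rewrite /n -natr1.
rewrite -/n in nhi.
exists n; split.
  have -> : N%:R / lam = il * N%:R by rewrite mulrC.
  have := nlo; have := nhi; rewrite nE /s mulrDl => h1 h2.
  by rewrite ler_norml; lra.
have n0 : (0 < n)%N by [].
apply: le_trans (partition_sum_neg hprim hcomp hlam hr hP hQ hmP hmQ prod_le t0 n0
  N0 _) _.
  move=> v lv sv; rewrite -(ler_nat R) natrD -/ms.
  have := hC1 v lv; rewrite sv ler_norml => /andP[h _].
  have : (lam - eta) * (s * N%:R) <= (lam - eta) * n%:R by rewrite ler_wpM2l ?ltW.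
  rewrite mulrA ls; lra.
rewrite -/ms -/K -mulrA ler_wpM2r //.
  by rewrite mulr_ge0 ?expR_ge0 // (partition_sum_ge0 hcomp _ hQ hmQ).
by apply: le_trans (expR_ge1Dx _); lra.
Unshelve. all: by end_near.
Qed.

Lemma partition_recursion_pos : 0 < t -> forall d, 0 < d ->
  \forall N \near \oo, exists n : nat,
    `|n%:R - N%:R / lam| <= d * N%:R /\
    Z t N <= expR (d * N%:R) * Z t n * expR (b * n%:R).
Proof.
move=> t0 d d0; have l1 := PF_eigenvalue_gt1 hprim hlam.
have l0 : 0 < lam by apply: lt_trans l1.
pose il := lam^-1; have il0 : 0 < il by rewrite invr_gt0.
have lil : lam * il = 1 by rewrite mulfV // gt_eqF.
have A1 : (0 < #|A|)%N by apply/card_gt0P; exists a0.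
pose al := ln (#|A|%:R : R).
have al0 : 0 <= al by rewrite ln_ge0 // ler1n.
(* The three bounds keep [s] positive, keep [n] close to [N / lam], and make the count of free
   letters at most [expR (d * N / 2)]. *)
pose e := Num.min (il / 2) (Num.min (d / 2) (d / (8 * lam * (al + 1)))).
have e0 : 0 < e by rewrite !lt_min !divr_gt0 // !mulr_gt0 // ltr_wpDl.
have e1 : e <= il / 2 by rewrite ge_min lexx.
have e2 : e <= d / 2 by rewrite !ge_min lexx orbT.
have e3 : lam * e * al <= d / 8.
  have : e <= d / (8 * lam * (al + 1)) by rewrite !ge_min lexx !orbT.
  rewrite ler_pdivlMr; last by rewrite !mulr_gt0 // ltr_wpDl.
  have := mulr_ge0 (ltW (mulr_gt0 l0 e0)) ler01; nra.
pose s := il - e; have s0 : il / 2 <= s by rewrite /s; lra.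
have sil : s <= il by rewrite /s; lra.
have le0 : 0 < lam * e by rewrite mulr_gt0.
pose eta := lam * (lam * e) / 2; have eta0 : 0 < eta
  by rewrite divr_gt0 // mulr_gt0.
have etas : eta * s <= lam * e / 2.
  apply: (@le_trans _ _ (eta * il)); first by rewrite ler_wpM2l // ltW.
  have -> : eta * il = lam * il * (lam * e) / 2 by rewrite /eta; ring.
  by rewrite lil mul1r.
have lel : lam * e <= 2^-1.
  by apply: (@le_trans _ _ (lam * (il / 2)));
    [rewrite ler_wpM2l // ltW | rewrite mulrA lil mul1r].
have etal : eta <= lam.
  rewrite /eta -mulrA -[leRHS]mulr1 ler_wpM2l ?(ltW l0) //; lra.
have ls : lam * s = 1 - lam * e by rewrite /s mulrBr lil.
have [C1 C10 hC1] := image_len_frequency a0 hprim hcomp hlam hr eta0.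
have [kap hkap] := partition_sum_pos hprim hcomp hrec hlam hr hP hQ hmP hmQ prod_le
  t0.
near=> N.
have N1 : (1 < N)%N by near: N; exact: nbhs_infty_gt.
have NR : 1 < N%:R :> R by rewrite ltr1n.
have n1 : 2 <= d * N%:R.
  rewrite mulrC -ler_pdivrMr //; near: N; exact: nbhs_infty_ger.
have n2 : 2 * lam <= N%:R by near: N; exact: nbhs_infty_ger.
have n3 : 2 * (C1 + kap%:R) <= lam * e * N%:R.
  rewrite [leRHS]mulrC -ler_pdivrMr //; near: N; exact: nbhs_infty_ger.
have n4 : 2 * (lam + C1) <= lam * e * N%:R.
  rewrite [leRHS]mulrC -ler_pdivrMr //; near: N; exact: nbhs_infty_ger.
have n5 : 8 * al <= d * N%:R.
  rewrite [leRHS]mulrC -ler_pdivrMr //; near: N; exact: nbhs_infty_ger.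
have n6 : 32 * expR C <= d ^+ 2 * N%:R.
  rewrite [leRHS]mulrC -ler_pdivrMr ?exprn_gt0 //; near: N; exact: nbhs_infty_ger.
have sN1 : 1 <= s * N%:R.
  apply: (@le_trans _ _ (il / 2 * N%:R)); last by rewrite ler_wpM2r // ltW.
  have := ler_wpM2l (ltW il0) n2.
  have -> : il * (2 * lam) = 2 * (lam * il) by ring.
  by rewrite lil; lra.
have sN : 0 <= s * N%:R by apply: le_trans sN1.
have /andP[nlo nhi] := truncn_itv sN.
pose n := Num.truncn (s * N%:R); rewrite -/n in nlo nhi; rewrite -natr1 in nhi.
exists n; split.
  have -> : N%:R / lam = il * N%:R by rewrite mulrC.
  have : e * N%:R <= d / 2 * N%:R by rewrite ler_wpM2r.
  have := mulr_ge0 (ltW e0) (ler0n R N).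
  have := nlo; have := nhi; rewrite /s mulrBl => h1 h2 h3 h4.
  by rewrite ler_norml; lra.
have n0 : (0 < n)%N by rewrite truncn_gt0.
have etasN : eta * s * N%:R <= lam * e / 2 * N%:R by rewrite ler_wpM2r.
(* Letters outside the inner image: [lam * e * N] by the choice of [s], the rest for [eta], rounding
   and [C1]. *)
pose D := (Num.truncn (2 * (lam * e) * N%:R)).+1.
have DR : 0 <= 2 * (lam * e) * N%:R by rewrite !mulr_ge0 // ltW.
have /andP[Dlo Dhi] := truncn_itv DR; rewrite -/D in Dhi.
have DE : D%:R = (Num.truncn (2 * (lam * e) * N%:R))%:R + 1 :> R
  by rewrite /D -natr1.
apply: le_trans (hkap N n D N1 n0 _ _) _.
- move=> v lv sv; rewrite -(ler_nat R) natrD.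
  have := hC1 v lv; rewrite ler_norml => /andP[_ h].
  have svn : (size v)%:R <= s * N%:R by apply: le_trans nlo; rewrite ler_nat.
  have h1 : (lam + eta) * (size v)%:R <= (lam + eta) * (s * N%:R).
    by rewrite ler_wpM2l // addr_ge0 // ltW.
  rewrite [leRHS]mulrA !mulrDl ls mulrDl in h1; lra.
- move=> v lv sv; rewrite -(ler_nat R) natrD.
  have := hC1 v lv; rewrite sv ler_norml => /andP[h _].
  have h1 : (lam - eta) * (s * N%:R - 1) <= (lam - eta) * n%:R.
    by rewrite ler_wpM2l ?subr_ge0 //; lra.
  have h2 : (lam - eta) * (s * N%:R - 1) =
    N%:R - lam * e * N%:R - eta * s * N%:R - lam + eta.
    rewrite mulrBl [lam * (_ - _)]mulrBr mulrA ls; ring.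
  rewrite h2 in h1; lra.
rewrite -[leRHS]mulrA ler_wpM2r //.
  by rewrite mulr_ge0 ?expR_ge0 // (partition_sum_ge0 hcomp _ hQ hmQ).
have AD : (#|A| ^ D)%:R <= expR (d * N%:R / 2).
  rewrite natrX -[#|A|%:R]lnK ?posrE ?ltr0n // -/al -expRM_natl ler_expR.
  have h1 : D%:R * al <= (2 * (lam * e) * N%:R + 1) * al.
    by rewrite ler_wpM2r // DE lerD2r.
  have h2 : lam * e * al * N%:R <= d / 8 * N%:R by rewrite ler_wpM2r.
  have h3 : (2 * (lam * e) * N%:R + 1) * al = 2 * (lam * e * al * N%:R) + al
    by ring.
  lra.
have NC : N.+1%:R * expR C <= expR (d * N%:R / 2).
  by rewrite -natr1 linear_le_expR ?expR_ge0 // ltW.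
have -> : N.+1%:R * (#|A| ^ D)%:R * expR C = N.+1%:R * expR C * (#|A| ^ D)%:R
  by rewrite mulrAC.
have -> : expR (d * N%:R) = expR (d * N%:R / 2) * expR (d * N%:R / 2).
  by rewrite -expRD; congr expR; field.
by rewrite ler_pM // mulr_ge0 ?expR_ge0.
Unshelve. all: by end_near.
Qed.

End Recursion.

(** * Large deviations and almost sure convergence *)

Section LargeDeviations.
Variables (R : realType) (A : finType) (a0 : A) (theta : substitution A).
Hypotheses (hprim : subst_primitive R theta) (hcomp : compatible theta)
  (hrec : recognisable theta).
Variables (lam : R) (r : A -> R).
Hypotheses (hlam : PF_eigenvalue theta lam)
  (hr : PF_right_eigenvector theta lam r).
Variables (P Q : A -> seq A -> R) (mP mQ : seq A -> R).
Hypotheses (hP : permissible theta P) (hQ : permissible theta Q)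
  (hmP : word_frequency a0 theta P mP) (hmQ : word_frequency a0 theta Q mQ).

Notation L := ((lam - 1)^-1 * mean_cross_entropy theta r P Q).

Lemma partition_sum_growth (eta : R) : 0 < eta -> exists2 t0, 0 < t0 &
  forall t, `|t| <= t0 -> t != 0 -> exists2 K, 0 < K & forall N,
  partition_sum mP mQ t N <= K * expR ((- t * L + `|t| * eta) * N%:R).
Proof.
move=> eta0; have l1 := PF_eigenvalue_gt1 hprim hlam.
have l10 : 0 < lam - 1 by rewrite subr_gt0.
(* The factor [lam - 1] cancels in the growth rate; the half leaves the strict inequality required
   by [renormalised_growth]. *)
have e0 : 0 < (lam - 1) * eta / 2 by rewrite divr_gt0 // mulr_gt0.
have [t0 t00 ht] := prod_moment_le a0 hprim hcomp hlam hr hP hQ e0.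
exists t0 => // t tt0 tn0; have [C C0 prod_le] := ht t tt0.
apply: (@renormalised_growth _ _ lam (- t * mean_cross_entropy theta r P Q +
    (lam - 1) * eta / 2 * `|t|) _ l1); last 2 first.
- exact: (partition_sum_ge0 hcomp _ hQ hmQ).
- move=> d d0; have [tneg|tpos|teq] := ltrgtP t 0.
  + exact: (partition_recursion_neg hprim hcomp hlam hr hP hQ hmP hmQ prod_le tneg
    d0).
  + exact: (partition_recursion_pos hprim hcomp hrec hlam hr hP hQ hmP hmQ prod_le
    tpos d0).
  + by rewrite teq eqxx in tn0.
have at0 : 0 < `|t| by rewrite normr_gt0.
rewrite ltr_pdivrMr // [ltRHS]mulrDl.
have -> : - t * L * (lam - 1) = - t * mean_cross_entropy theta r P Q.
  by field; rewrite gt_eqF.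
rewrite ltrD2l; have := mulr_gt0 at0 (mulr_gt0 l10 eta0).
set x := lam - 1; nra.
Qed.

(** Exponential Markov inequality for both tails at once: the sign of [t] selects the tail. *)
Lemma deviation_sum_le (t eta : R) N : (0 < N)%N ->
  \sum_(w <- words A N | `|t| * eta * N%:R < t * (ln (mP w) + L * N%:R)) mQ w <=
  expR ((t * L - `|t| * eta) * N%:R) * partition_sum mP mQ t N.
Proof.
move=> N0; rewrite /partition_sum mulr_sumr big_mkcond /=.
rewrite [leLHS]big_seq [leRHS]big_seq; apply: ler_sum => w.
rewrite mem_words => /eqP sw.
have mQ0 := frequency_ge0 hcomp hQ hmQ w.
case: ifP => [h|_]; last by rewrite !mulr_ge0 ?expR_ge0 ?powR_ge0.
have [lw|nlw] := pselect (legal theta w); last first.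
  by rewrite (frequency_illegal hprim hcomp hlam hr hQ hmQ nlw) mul0r mulr0.
have w0 : w != [::] by move: N0; rewrite -sw; case: (w).
have m0 := frequency_gt0 hprim hcomp hlam hr hP hmP w0 lw.
rewrite mulrCA -[leLHS]mulr1 ler_wpM2l // /powR gt_eqF // -expRD.
apply: le_trans (expR_ge1Dx _); rewrite lerDl; move: h; set H :=
  _ * mean_cross_entropy _ _ _ _; lra.
Qed.

Lemma large_deviation (eta : R) : 0 < eta -> exists K q : R,
  [/\ 0 <= K, 0 <= q, q < 1 & forall N, (0 < N)%N ->
    \sum_(w <- words A N | eta * N%:R < `|ln (mP w) + L * N%:R|) mQ w <=
    K * q ^+ N].
Proof.
(* Growth is controlled up to [eta / 2] against a threshold [eta], so each tail decays like
   [expR (- (t * eta / 2) * N)]. *)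
move=> eta0; have e0 : 0 < eta / 2 by rewrite divr_gt0.
have [t t0 ht] := partition_sum_growth e0.
have [||K1 K10 h1] := ht t; rewrite ?gtr0_norm // ?gt_eqF //.
have [||K2 K20 h2] := ht (- t); rewrite ?normrN ?gtr0_norm // ?oppr_eq0 ?gt_eqF //.
exists (K1 + K2), (expR (- (t * eta / 2))); split.
- by rewrite addr_ge0 // ltW.
- exact: expR_ge0.
- by rewrite -expR0 ltr_expR oppr_lt0 divr_gt0 // mulr_gt0.
move=> N N0; have mQ0 := frequency_ge0 hcomp hQ hmQ.
have := deviation_sum_le t eta N0; have := deviation_sum_le (- t) eta N0.
rewrite normrN gtr0_norm // => d2 d1.
apply: (@le_trans _ _
  (\sum_(w <- words A N | t * eta * N%:R < t * (ln (mP w) + L * N%:R)) mQ w +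
   \sum_(w <- words A N | t * eta * N%:R < - t * (ln (mP w) + L * N%:R)) mQ w)).
  rewrite [leLHS]big_mkcond [X in _ <= X + _]big_mkcond.
  rewrite [X in _ <= _ + X]big_mkcond -big_split /=; apply: ler_sum => w _.
  rewrite -!mulrA -[- t]mulN1r -mulrA [-1 * _]mulrCA mulN1r !ltr_pM2l //.
  rewrite real_ltr_normr ?num_real //.
  by do 2 case: (_ < _); rewrite /= ?addr0 ?add0r // ?ler_wpDl ?addr_ge0.
rewrite mulrDl; apply: lerD.
  apply: le_trans d1 _; rewrite -expRM_natl.
  apply: le_trans (ler_wpM2l (expR_ge0 _) (h1 N)) _.
  rewrite mulrCA -expRD ler_wpM2l ?(ltW K10) // ler_expR.
  by rewrite gtr0_norm //; set H := _ * mean_cross_entropy _ _ _ _; lra.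
apply: le_trans d2 _; rewrite -expRM_natl.
apply: le_trans (ler_wpM2l (expR_ge0 _) (h2 N)) _.
rewrite mulrCA -expRD ler_wpM2l ?(ltW K20) // ler_expR.
by rewrite normrN gtr0_norm //; set H := _ * mean_cross_entropy _ _ _ _; lra.
Qed.

End LargeDeviations.

Lemma factorS (A : finType) (x : int -> A) i n :
  factor x i n.+1 = x i :: factor x (i + 1) n.
Proof.
rewrite /factor /mkseq /= addr0 -[1%N]addn0 iotaDl -map_comp; congr cons.
by apply: eq_map => j /=; rewrite PoszD addrA.
Qed.

Lemma factor_infix (A : finType) (x : int -> A) (i j : int) (n k : nat) :
  j <= i -> i + n%:Z <= j + k%:Z -> infix (factor x i n) (factor x j k).
Proof.
move=> ji h; set d := absz (i - j).
have -> : factor x i n = take n (drop d (factor x j k)).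
  rewrite /factor /mkseq -map_drop -map_take drop_iota take_iota.
  have -> : minn n (k - d) = n by lia.
  rewrite [(0 + d)%N]addnC iotaDl -map_comp.
  apply: eq_map => l /=; congr x; lia.
exact: infix_trans (prefixW (prefix_take _ _)) (suffixW (suffix_drop _ _)).
Qed.

(** * Measurability and masses of cylinders *)

Section Cylinders.
Variables (R : realType) (A : finType) (a0 : A) (theta : substitution A).

Lemma measurable_coordinate i a :
  measurable [set x : borel_full_shift a0 | x i = a].
Proof.
apply: sub_sigma_algebra.
have -> : [set x : full_shift a0 | x i = a] =
    (@proj int (fun=> discrete_topology A) i) @^-1` [set a] by [].
apply: open_comp; last exact: discrete_open.
by move=> x _; exact: proj_continuous.
Qed.

Lemma measurable_factor (E : set (seq A)) i n :
  measurable [set x : borel_full_shift a0 | E (factor x i n)].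
Proof.
elim: n i E => [|n IH] i E.
  have [h|h] := pselect (E [::]).
    rewrite (_ : [set _ | _] = setT); first exact: measurableT.
    by apply/seteqP; split.
  rewrite (_ : [set _ | _] = set0); first exact: measurable0.
  by apply/seteqP; split.
rewrite (_ : [set _ | _] = \bigcup_(a in [set` enum A])
   ([set x : borel_full_shift a0 | x i = a] `&`
    [set x | E (a :: factor x (i + 1) n)])).
  apply: fin_bigcup_measurable; first exact: finite_seq.
  move=> a _; apply: measurableI; first exact: measurable_coordinate.
  exact: (IH _ (fun w => E (a :: w))).
apply/seteqP; split=> x /=.
  by rewrite factorS => h; exists (x i) => //=; rewrite mem_enum.
by move=> [a _ [/= <-]]; rewrite factorS.
Qed.

Lemma measurable_subshift :
  measurable (subshift theta : set (borel_full_shift a0)).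
Proof.
rewrite (_ : subshift theta = \bigcap_n
  [set x : borel_full_shift a0 | legal theta (factor x (- n%:Z) (n + n))]).
  apply: bigcapT_measurable => n; exact: measurable_factor.
apply/seteqP; split=> x h; first by move=> n _; apply: h.
move=> i n; apply: legal_infix (h (absz i + n)%N I).
by apply: factor_infix; lia.
Qed.

(** Central windows start at [- n] and [cylinder] at 1; shift invariance will identify their
    masses. *)
Definition cylinder_at (i : int) (v : seq A) : set (borel_full_shift a0) :=
  [set x | subshift theta x /\ factor x i (size v) = v].

Lemma measurable_cylinder_at i v : measurable (cylinder_at i v).
Proof.
apply: (measurableI _ _ measurable_subshift).
exact: (@measurable_factor [set w | w = v]).
Qed.

Lemma cylinder_at_illegal i v : ~ legal theta v -> cylinder_at i v = set0.
Proof. by move=> nv; apply/seteqP; split=> // x [Xx xv]; case: nv; rewrite -xv;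
  apply: Xx. Qed.

Lemma central_cylinderE (x : int -> A) n : central_cylinder theta x n =
  cylinder_at (- n%:Z) (factor x (- n%:Z) n.*2.+1).
Proof.
apply/seteqP; split=> y [Xy h]; split=> //.
  rewrite size_mkseq; apply: (@eq_from_nth _ a0); first by rewrite !size_mkseq.
  move=> j; rewrite size_mkseq => jn; rewrite !nth_mkseq //; apply: h; lia.
move=> j jn; have := congr1 (nth a0 ^~ (absz (j + n%:Z))) h.
rewrite size_mkseq /= !nth_mkseq; [|lia|lia].
by have -> : - n%:Z + (absz (j + n%:Z))%:Z = j by lia.
Qed.

Lemma shift_factor (x : int -> A) k i n :
  factor (shift k x) i n = factor x (i + k) n.
Proof. by apply: eq_mkseq => j; rewrite /shift addrAC. Qed.

Lemma shift_subshift k (x : int -> A) : subshift theta (shift k x) <-> subshift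
  theta x.
Proof.
split=> h i n; last by rewrite shift_factor; exact: h.
by have := h (i - k) n; rewrite shift_factor subrK.
Qed.

Section Measure.
Variables (P : A -> seq A -> R) (mu : probability (borel_full_shift a0) R).
Hypotheses (hP : permissible theta P) (hmu : frequency_measure theta P mu).

Lemma mu_cylinder_at i v : mu (cylinder_at i v) = mu (cylinder theta v).
Proof.
have step j : mu (cylinder_at (j + 1) v) = mu (cylinder_at j v).
  have [_ inv _] := hmu; rewrite -(inv _ (measurable_cylinder_at j v)).
  congr (mu _); apply/seteqP; split=> x [Xx h]; split.
  - by apply/shift_subshift.
  - by rewrite shift_factor.
  - by move: Xx => /shift_subshift.
  - by move: h; rewrite shift_factor.
suff h j : mu (cylinder_at j v) = mu (cylinder_at 0 v).
  by rewrite h -(h 1).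
elim/int_ind: j => // j IH; first by rewrite -addn1 PoszD step.
by rewrite -step (_ : - j.+1%:Z + 1 = - j%:Z) //; lia.
Qed.

Definition cylinder_mass (v : seq A) : R := fine (mu (cylinder theta v)).

Lemma cylinder_massE v : mu (cylinder theta v) = (cylinder_mass v)%:E.
Proof. by rewrite /cylinder_mass fineK // fin_num_measure //;
  exact: measurable_cylinder_at. Qed.

(** The definition of [frequency_measure] covers legal words; for illegal ones the cylinder is empty
    and all counts are 0. *)
Lemma cylinder_mass_frequency : word_frequency a0 theta P cylinder_mass.
Proof.
move=> v; have [lv|nlv] := pselect (legal theta v).
  by have [_ _] := hmu; apply.
rewrite /cylinder_mass -(mu_cylinder_at 1) (cylinder_at_illegal 1 nlv) measure0 /=.
rewrite (_ : (fun _ => _) = fun=> 0); first exact: cvg_cst.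
apply/funext => k; rewrite (_ : iter_mean theta P k [:: a0] _ = 0) ?mul0r //.
rewrite -[RHS](iter_mean_cst hP k [:: a0]); apply: eq_iter_mean => x xk.
by rewrite (occ_illegal (legal_iter xk) nlv).
Qed.

Lemma mu_factor_le (E : pred (seq A)) i N :
  (mu [set x : borel_full_shift a0 | subshift theta x /\ E (factor x i N)] <=
   (\sum_(w <- words A N | E w) cylinder_mass w)%:E)%E.
Proof.
pose U s := \big[setU/set0]_(w <- s | E w) cylinder_at i w.
have mU s : measurable (U s).
  by apply: bigsetU_measurable => w _; exact: measurable_cylinder_at.
have leU s : (mu (U s) <= (\sum_(w <- s | E w) cylinder_mass w)%:E)%E.
  rewrite /U; elim: s => [|w s IH]; first by rewrite !big_nil measure0.
  rewrite !big_cons; case: ifP => // _.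
  apply: (le_trans (measureU2 _ (measurable_cylinder_at i w) (mU s))).
  by rewrite EFinD -cylinder_massE -(mu_cylinder_at i); apply: leeD2l.
apply: le_trans (leU _); apply: le_measure; rewrite ?inE.
- apply: (measurableI _ _ measurable_subshift).
  exact: (@measurable_factor E).
- exact: mU.
move=> x [Xx Ex]; rewrite /U.
rewrite -bigcup_seq_cond; exists (factor x i N); last first.
  by split=> //; rewrite size_mkseq.
by rewrite /= mem_words size_mkseq eqxx.
Qed.

End Measure.

End Cylinders.

Lemma nneseries_geometric_lty (R : realType) (u : nat -> \bar R) (K q : R) :
  0 <= K -> 0 <= q -> q < 1 ->
  (forall n, 0 <= u n <= (K * q ^+ n)%:E)%E ->
  (\sum_(0 <= n <oo) u n < +oo)%E.
Proof.
move=> K0 q0 q1 hu; apply: (@le_lt_trans _ _ (K / (1 - q))%:E); last exact: ltry.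
apply: lime_le.
  by apply: is_cvg_nneseries => n _ _; have /andP[] := hu n.
near=> n; apply: (@le_trans _ _ (\sum_(0 <= i < n) (K * q ^+ i)%:E)%E).
  by apply: lee_sum => i _; have /andP[] := hu i.
rewrite sumEFin lee_fin big_mkord -mulr_sumr ler_wpM2l //.
rewrite -[leRHS]mul1r ler_pdivlMr ?subr_gt0 //.
have := subrX1 q n; have := exprn_ge0 n q0.
move: (\sum_(i < n) q ^+ i) (q ^+ n) => S X; nra.
Unshelve. all: by end_near.
Qed.

(** * Borel--Cantelli and the local dimension *)

Section AlmostEverywhere.
Variables (R : realType) (A : finType) (a0 : A) (theta : substitution A).
Hypotheses (hprim : subst_primitive R theta) (hcomp : compatible theta)
  (hrec : recognisable theta).
Variables (lam : R) (r : A -> R).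
Hypotheses (hlam : PF_eigenvalue theta lam)
  (hr : PF_right_eigenvector theta lam r).
Variables (P Q : A -> seq A -> R) (muP muQ : probability (borel_full_shift a0) R).
Hypotheses (hP : permissible theta P) (hQ : permissible theta Q)
  (hmuP : frequency_measure theta P muP) (hmuQ : frequency_measure theta Q muQ).

Notation L := ((lam - 1)^-1 * mean_cross_entropy theta r P Q).
Notation mP := (cylinder_mass theta muP).

Lemma ae_central_mass (eta : R) : 0 < eta ->
  \forall x \ae muQ, subshift theta x -> \forall n \near \oo,
    `|ln (mP (factor x (- n%:Z) n.*2.+1)) + L * n.*2.+1%:R| <= eta * n.*2.+1%:R.
Proof.
move=> eta0.
have hmP := cylinder_mass_frequency hP hmuP.
have hmQ := cylinder_mass_frequency hQ hmuQ.
have [K [q [K0 q0 q1 hsum]]] :=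
  large_deviation hprim hcomp hrec hlam hr hP hQ hmP hmQ eta0.
pose E n (w : seq A) := eta * n.*2.+1%:R < `|ln (mP w) + L * n.*2.+1%:R|.
pose B n := [set x : borel_full_shift a0 |
  subshift theta x /\ E n (factor x (- n%:Z) n.*2.+1)].
have mB n : measurable (B n).
  apply: (measurableI _ _ (measurable_subshift theta)).
  exact: (@measurable_factor _ _ (E n)).
have B0 : muQ (lim_sup_set B) = 0%E.
  apply: lim_sup_set_cvg0 => //.
  apply: (nneseries_geometric_lty K0 q0 q1) => n.
  rewrite measure_ge0 /=; apply: le_trans (mu_factor_le hmuQ _ _ _) _.
  rewrite lee_fin; apply: le_trans (hsum _ _) _ => //.
  (* The words have length [2 * n + 1], and [q ^+ (2 * n + 1) <= q ^+ n] keeps the series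
     geometric. *)
  rewrite ler_wpM2l // ler_wiXn2l ?(ltW q1) //.
  by rewrite -addnn -addnS leq_addr.
exists (lim_sup_set B); split => //.
  by apply: bigcapT_measurable => n; apply: bigcup_measurable.
move=> x /=; apply: contra_notP => nB Xx.
have [n0 hn0] : exists n0, forall j, (n0 <= j)%N -> ~ B j x.
  apply: contrapT => h; apply: nB => n _.
  apply: contrapT => h'; apply: h; exists n => j nj Bj.
  by apply: h'; exists j.
exists n0 => // n /= n0n; rewrite leNgt; apply/negP => h.
by apply: (hn0 n n0n).
Qed.

Lemma local_dim_ae : \forall x \ae muQ, subshift theta x ->
  local_dim_seq theta muP x n @[n --> \oo] --> L%:E.
Proof.
have hmP := cylinder_mass_frequency hP hmuP.
(* Countably many tolerances, so that a single null set serves them all. *)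
have : \forall x \ae muQ, forall k, subshift theta x -> \forall n \near \oo,
    `|ln (mP (factor x (- n%:Z) n.*2.+1)) + L * n.*2.+1%:R|
    <= k.+1%:R^-1 * n.*2.+1%:R.
  by apply: ae_foralln => k; apply: ae_central_mass.
apply: filterS; first exact: (ae_filter_ringOfSetsType muQ).
move=> x h Xx; have seqE n : local_dim_seq theta muP x n =
    (- (n.*2.+1%:R^-1 * ln (mP (factor x (- n%:Z) n.*2.+1))))%:E.
  rewrite /local_dim_seq (central_cylinderE a0) (mu_cylinder_at hmuP).
  rewrite (cylinder_massE theta muP) lne_EFin -?EFinM ?mulNr //.
  (* Factors of points of the subshift are legal, so their mass is positive and [lne] agrees with
     [ln]. *)
  apply: (frequency_gt0 hprim hcomp hlam hr hP hmP) => //; exact: Xx.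
under eq_fun do rewrite seqE.
apply: cvg_EFin; first exact: nearW.
apply/cvgrPdist_le => /= e e0.
have [k ke] : exists k : nat, k.+1%:R^-1 <= e.
  exists (Num.truncn e^-1); rewrite -[leRHS]invrK lef_pV2 ?posrE ?invr_gt0 //.
  by apply/ltW; have /andP[] := truncn_itv (ltW (eqbRL (invr_gt0 e) e0)).
have hk := h k Xx; near=> n.
have hn : `|ln (mP (factor x (- n%:Z) n.*2.+1)) + L * n.*2.+1%:R|
    <= k.+1%:R^-1 * n.*2.+1%:R by near: n.
apply: le_trans ke; rewrite -(@ler_pM2r _ n.*2.+1%:R) ?ltr0n //.
apply: le_trans hn; rewrite opprK -[X in _ * X <= _]ger0_norm ?ler0n // -normrM.
rewrite le_eqVlt; apply/orP; left; apply/eqP; congr `|_|.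
rewrite mulrDl addrC; congr (_ + _).
by rewrite mulrAC mulVf ?mul1r // pnatr_eq0.
Unshelve. all: by end_near.
Qed.

End AlmostEverywhere.

Theorem proposition4p5 (R : realType) (A : finType) (a0 : A)
    (theta : substitution A)
    (hprim : subst_primitive R theta) (hcomp : compatible theta)
    (hrec : recognisable theta)
    (lam : R) (hlam : PF_eigenvalue theta lam)
    (r : A -> R) (hr : PF_right_eigenvector theta lam r)
    (P Q : A -> seq A -> R)
    (hP : permissible theta P) (hQ : permissible theta Q)
    (muP muQ : probability (borel_full_shift a0) R)
    (hmuP : frequency_measure theta P muP)
    (hmuQ : frequency_measure theta Q muQ) :
  \forall x \ae muQ, subshift theta x ->
    local_dim_exists theta muP x /\
    local_dim theta muP x =
      ((lam - 1)^-1 *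
       \sum_(a : A) r a * \sum_(v <- theta a) - (Q a v * ln (P a v)))%:E.
Proof.
have := local_dim_ae hprim hcomp hrec hlam hr hP hQ hmuP hmuQ.
apply: filterS; first exact: (ae_filter_ringOfSetsType muQ).
move=> x h Xx; have hx := h Xx; split.
  by apply/cvg_ex; eexists; exact: hx.
exact: cvg_lim hx.
Qed.
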